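(* The constant term satisfies $$\frac{1}{2\pi i}\int_{C}\frac{(x^2,x^{-2};q)_\infty}{(ax,ax^{-1},bx,bx^{-1},cx,cx^{-1},dx,dx^{-1};q)_\infty}\frac{dx}{x}=\frac{2\,(abcd;q)_\infty}{(q,ab,ac,ad,bc,bd,cd;q)_\infty}.$$
   Context: $(y;q)_\infty=\prod_{j\ge0}(1-yq^j)$ and $(y_1,\dots,y_r;q)_\infty=\prod_i(y_i;q)_\infty$. Parameters: $q\in\mathbb C$ with $0<|q|<1$ and a fixed square root $q^{1/2}$; $a=k_1u_1$, $b=-k_1u_1^{-1}$, $c=q^{1/2}k_0u_0$, $d=-q^{1/2}k_0u_0^{-1}$ for nonzero complex numbers $k_0,k_1,u_0,u_1$ with $k_0^2,k_1^2,u_1^2\notin\{\pm q^j:j\in\mathbb Z\}$, and $ef\notin q^{\mathbb Z}$ for all $e,f\in\{a,b,c,d\}$ (including $e=f$). $C$ is a counterclockwise oriented continuous rectifiable Jordan curve such that $aq^k,bq^k,cq^k,dq^k$ ($k\in\mathbb Z_{\ge0}$) (and hence $0$) lie in its interior and $a^{-1}q^{-k},b^{-1}q^{-k},c^{-1}q^{-k},d^{-1}q^{-k}$ ($k\in\mathbb Z_{\ge0}$) lie in its exterior. *)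

(* Defs.v *)
From HB Require Import structures.
From mathcomp Require Import all_boot all_order all_algebra.
From mathcomp Require Import complex.
From mathcomp Require Import all_classical all_reals all_analysis.

Set Implicit Arguments.
Unset Strict Implicit.
Unset Printing Implicit Defensive.

Import Order.TTheory GRing.Theory Num.Theory.
Import numFieldTopology.Exports numFieldNormedType.Exports.

Local Open Scope classical_set_scope.
Local Open Scope ring_scope.
Local Open Scope complex_scope.

(* The topology and the norm of R[i] are those the library puts on every
   numFieldType; they are only inferred for R[i]^o unless copied. *)
HB.instance Definition _ (R : realType) := NormedModule.copy R[i] R[i]^o.

Section QPochhammer.
Variable R : realType.

Definition qpoch (y q : R[i]) : R[i] :=
  lim ((fun n : nat => \prod_(j < n) (1 - y * q ^+ j)) @ \oo).

Definition qpochs (ys : seq R[i]) (q : R[i]) : R[i] :=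
  \prod_(y <- ys) qpoch y q.

End QPochhammer.

(* Curves are parametrised by [0, 1].  A partition of [0, 1] is a sequence s
   with itv_partition 0 1 s, i.e. 0 :: s is strictly increasing and ends at 1;
   its points are nth 1 (0 :: s) k for k <= size s. *)
Section Curves.
Variable R : realType.
Implicit Types (g : R -> R[i]) (f : R[i] -> R[i]).

Definition curve g : set R[i] := g @` `[0, 1].

Definition jordan_curve g : Prop :=
  [/\ {within `[0, 1], continuous g}, g 0 = g 1
    & {in `[0, 1[ &, injective g}].

Definition rectifiable g : Prop :=
  exists M : R, forall s, itv_partition 0 1 s ->
    \sum_(k < size s)
      `| g (nth 1 (0 :: s) k.+1) - g (nth 1 (0 :: s) k) | <= M%:C.

(* t k is the tag of the k-th subinterval, and d bounds the mesh. *)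
Definition tagged_partition (d : R) (s : seq R) (t : nat -> R) : Prop :=
  itv_partition 0 1 s /\
  forall k, (k < size s)%N ->
    nth 1 (0 :: s) k <= t k <= nth 1 (0 :: s) k.+1 /\
    nth 1 (0 :: s) k.+1 - nth 1 (0 :: s) k < d.

Definition riemann_stieltjes_sum g f (s : seq R) (t : nat -> R) : R[i] :=
  \sum_(k < size s)
    f (g (t k)) * (g (nth 1 (0 :: s) k.+1) - g (nth 1 (0 :: s) k)).

(* The integral of f(x) dx along g exists and equals I. *)
Definition is_curve_integral g f (I : R[i]) : Prop :=
  forall e : R, 0 < e -> exists2 d : R, 0 < d &
    forall s t, tagged_partition d s t ->
      `| riemann_stieltjes_sum g f s t - I | < e%:C.

Definition two_pi_i : R[i] := 2 * pi%:C * 'i%C.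

(* By the Jordan curve theorem the complement of a Jordan curve has exactly one
   bounded and one unbounded connected component. *)
Definition curve_interior g : set R[i] :=
  [set p | ~ curve g p /\ bounded_set (connected_component (~` curve g) p)].

Definition curve_exterior g : set R[i] :=
  [set p | ~ curve g p /\ ~ bounded_set (connected_component (~` curve g) p)].

(* The winding number about every interior point is 1. *)
Definition counterclockwise g : Prop :=
  forall p, curve_interior g p ->
    is_curve_integral g (fun x => (x - p)^-1) two_pi_i.

End Curves.

(* Main.v *)
(* Write W_a for the integrand as a function of the parameter a, so that
   W_{aq}(x) = (1 - a x)(1 - a/x) W_a(x).  With
     h(x) = (x^2, q/x^2; q)_oo / prod_e (e x, q e/x; q)_oo    (e = a, b, c, d)
   one has the identity
     a (h(x) - q h(q x)) =
       ((1 - ab)(1 - ac)(1 - ad) - (1 - abcd)(1 - a x)(1 - a/x)) W_a(x).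
   Every pole of h has the same winding number for C as for q C, so the left-hand
   side integrates to 0.  Iterating, the integral of W_a is
   (abcd; q)_oo / (ab, ac, ad; q)_oo times that of W_0.  Removing the four
   parameters in turn leaves (x^2, x^-2; q)_oo / x, whose integral is read off the
   finite Jacobi triple product.

   No existence theorem for curve integrals is needed: all integrands are uniform
   limits on C of rational functions, integrated through their partial fractions.
   A pole of order at least 2 has a primitive; 1/(x - p) integrates to 2 pi i for p
   inside by hypothesis, and to 0 for p outside because the set of such p is open
   and closed in the complement of C (geometric series) and contains all large p. *)
Require Import Defs.
From HB Require Import structures.
From mathcomp Require Import all_boot all_order all_algebra.
From mathcomp Require Import complex.
From mathcomp Require Import all_classical all_reals all_analysis.
From mathcomp Require Import ring lra.

Set Implicit Arguments.
Unset Strict Implicit.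
Unset Printing Implicit Defensive.

Import Order.TTheory GRing.Theory Num.Theory.
Import numFieldTopology.Exports numFieldNormedType.Exports.

Local Open Scope classical_set_scope.
Local Open Scope ring_scope.
Local Open Scope complex_scope.

(** * Curve integrals *)

Section RealModulus.
Variable R : realType.
Implicit Types x y z : R[i].

(* The norm of R[i] takes its values in R[i], which is not totally ordered. *)
Definition cabs x : R := complex.Re `|x|.

Lemma cabsE x : `|x| = (cabs x)%:C.
Proof. by rewrite /cabs RRe_real ?normr_real. Qed.

Lemma cabs_ge0 x : 0 <= cabs x.
Proof. by rewrite -ler0c -cabsE normr_ge0. Qed.

Lemma cabs0 : cabs 0 = 0.
Proof. by apply: complexI; rewrite -cabsE normr0. Qed.

Lemma cabs1 : cabs 1 = 1.
Proof. by apply: complexI; rewrite -cabsE normr1. Qed.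

Lemma cabsN x : cabs (- x) = cabs x.
Proof. by apply: complexI; rewrite -!cabsE normrN. Qed.

Lemma cabsM x y : cabs (x * y) = cabs x * cabs y.
Proof. by apply: complexI; rewrite rmorphM /= -!cabsE normrM. Qed.

Lemma cabsX x n : cabs (x ^+ n) = cabs x ^+ n.
Proof. by apply: complexI; rewrite rmorphXn /= -!cabsE normrX. Qed.

Lemma cabsV x : cabs x^-1 = (cabs x)^-1.
Proof. by apply: complexI; rewrite fmorphV /= -!cabsE normfV. Qed.

Lemma cabsD x y : cabs (x + y) <= cabs x + cabs y.
Proof. by rewrite -lecR rmorphD /= -!cabsE ler_normD. Qed.

Lemma cabs_distC x y : cabs (x - y) = cabs (y - x).
Proof. by rewrite -cabsN opprB. Qed.

Lemma cabsB x y : cabs (x - y) <= cabs x + cabs y.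
Proof. by rewrite -(cabsN y) cabsD. Qed.

Lemma cabs_triangle x y z : cabs (x - z) <= cabs (x - y) + cabs (y - z).
Proof. by rewrite -[x - z](subrKA y) cabsD. Qed.

Lemma cabs_sub_ge x y : cabs x - cabs y <= cabs (x - y).
Proof. by rewrite lerBlDr -{1}(subrK y x) cabsD. Qed.

Lemma cabs_eq0 x : (cabs x == 0) = (x == 0).
Proof. by rewrite -(inj_eq (@complexI R)) -cabsE normr_eq0. Qed.

Lemma cabs_gt0 x : (0 < cabs x) = (x != 0).
Proof. by rewrite lt_def cabs_ge0 andbT cabs_eq0. Qed.

Lemma cabs_sum (I : Type) (r : seq I) (P : pred I) (F : I -> R[i]) :
  cabs (\sum_(i <- r | P i) F i) <= \sum_(i <- r | P i) cabs (F i).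
Proof.
elim/big_ind2 : _ => [|x1 x2 y1 y2 h1 h2|//]; first by rewrite cabs0.
exact: le_trans (cabsD _ _) (lerD h1 h2).
Qed.

(** Radii of balls in [R[i]] are themselves elements of [R[i]]; a positive one is real, so its real
    part serves as the radius. *)
Lemma nbhs_cabsP x (A : set R[i]) :
  nbhs x A <-> exists2 e : R, 0 < e & forall y, cabs (y - x) < e -> A y.
Proof.
split.
  move=> /nbhs_ballP[e /= e0 eA].
  have er : e = (complex.Re e)%:C by rewrite RRe_real // gtr0_real.
  exists (complex.Re e); first by rewrite -ltcR -er.
  move=> y yx; apply: eA; rewrite -ball_normE /= cabsE er ltcR.
  by rewrite cabs_distC.
move=> [e e0 eA]; apply/nbhs_ballP; exists e%:C => /=; first by rewrite ltcR.
move=> y; rewrite -ball_normE /= cabsE ltcR => yx; apply: eA.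
by rewrite cabs_distC.
Qed.

Lemma open_cabsP (A : set R[i]) :
  open A <-> forall x, A x -> exists2 e : R, 0 < e &
     forall y, cabs (y - x) < e -> A y.
Proof.
split=> [oA x Ax|h].
  by apply/nbhs_cabsP; exact: open_nbhs_nbhs.
by rewrite openE => x Ax; apply/nbhs_cabsP; exact: h.
Qed.

Lemma cvg_cabsP (u : nat -> R[i]) (l : R[i]) :
  u @ \oo --> l <-> forall e : R, 0 < e -> exists N : nat, forall n, (N <= n)%N ->
    cabs (u n - l) < e.
Proof.
split.
  move=> ul e e0.
  have : nbhs l [set y | cabs (y - l) < e] by apply/nbhs_cabsP; exists e.
  by move=> /ul [N _ hN]; exists N => n Nn; exact: hN.
move=> h A /nbhs_cabsP[e e0 eA].
have [N hN] := h e e0; exists N => // n /= Nn; exact/eA/hN.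
Qed.

End RealModulus.

Section CurveIntegral.
Variables (R : realType) (g : R -> R[i]).
Implicit Types f : R[i] -> R[i].

Lemma tagged_partition_in (d : R) s t k : tagged_partition d s t ->
  (k < size s)%N -> curve g (g (t k)).
Proof.
move=> [ps h] ks; have [/andP[h1 h2] _] := h k ks.
exists (t k) => //; rewrite /= in_itv /=.
rewrite (le_trans _ h1) ?(le_trans h2) //.
- by apply: itv_partition_nth_le.
- by apply: itv_partition_nth_ge => //; rewrite ltnS ltnW.
Qed.

(** Tags are parameters in the unit interval, so Riemann sums sample the integrand on the curve
    only. Identities between integrands may therefore use that denominators do not vanish there. *)
Lemma is_curve_integral_eq f1 f2 I : (forall x, curve g x -> f1 x = f2 x) ->
  is_curve_integral g f1 I -> is_curve_integral g f2 I.
Proof.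
move=> f12 h e e0; have [d d0 hd] := h e e0; exists d => // s t st.
have -> : riemann_stieltjes_sum g f2 s t = riemann_stieltjes_sum g f1 s t.
  by apply: eq_bigr => k _; rewrite f12 //; exact: tagged_partition_in st _.
exact: hd.
Qed.

Lemma is_curve_integralP f I :
  is_curve_integral g f I <-> forall e : R, 0 < e -> exists2 d : R, 0 < d &
    forall s t, tagged_partition d s t ->
      cabs (riemann_stieltjes_sum g f s t - I) < e.
Proof.
split=> h e e0; have [d d0 hd] := h e e0; exists d => // s t /hd;
  by rewrite cabsE ltcR.
Qed.

Lemma is_curve_integral0 : is_curve_integral g (fun=> 0) 0.
Proof.
apply/is_curve_integralP => e e0; exists 1 => // s t _.
rewrite /riemann_stieltjes_sum big1 ?subr0 ?cabs0 // => k _.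
by rewrite mul0r.
Qed.

Lemma is_curve_integralD f1 f2 I1 I2 :
  is_curve_integral g f1 I1 -> is_curve_integral g f2 I2 ->
  is_curve_integral g (fun x => f1 x + f2 x) (I1 + I2).
Proof.
move=> /is_curve_integralP h1 /is_curve_integralP h2.
apply/is_curve_integralP => e e0.
have e20 : 0 < e / 2 by lra.
have [d1 d10 hd1] := h1 _ e20; have [d2 d20 hd2] := h2 _ e20.
exists (Num.min d1 d2); first by rewrite lt_min d10.
move=> s t [ps hst].
have -> : riemann_stieltjes_sum g (fun x => f1 x + f2 x) s t =
   riemann_stieltjes_sum g f1 s t + riemann_stieltjes_sum g f2 s t.
  by rewrite -big_split /=; apply: eq_bigr => k _; rewrite mulrDl.
rewrite opprD addrACA (le_lt_trans (cabsD _ _)) //.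
have -> : e = e / 2 + e / 2 by lra.
apply: ltrD; [apply: hd1|apply: hd2]; split => // k ks;
  by have [? ] := hst k ks; rewrite lt_min => /andP[].
Qed.

Lemma is_curve_integralZ c f I :
  is_curve_integral g f I -> is_curve_integral g (fun x => c * f x) (c * I).
Proof.
move=> /is_curve_integralP h; apply/is_curve_integralP => e e0.
have c0 := cabs_ge0 c.
have [|d d0 hd] := h (e / (cabs c + 1)); first by apply: divr_gt0 => //; lra.
exists d => // s t /hd.
have -> : riemann_stieltjes_sum g (fun x => c * f x) s t =
   c * riemann_stieltjes_sum g f s t.
  by rewrite /riemann_stieltjes_sum mulr_sumr; apply: eq_bigr => k _; rewrite mulrA.
rewrite -mulrBr cabsM ltr_pdivlMr; last lra.
have := cabs_ge0 (riemann_stieltjes_sum g f s t - I); nra.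
Qed.

Lemma is_curve_integral_sum (J : Type) (r : seq J) (F : J -> R[i] -> R[i]) (I : J -> R[i]) :
  (forall j, is_curve_integral g (F j) (I j)) ->
  is_curve_integral g (fun x => \sum_(j <- r) F j x) (\sum_(j <- r) I j).
Proof.
move=> h; elim: r => [|j r ih].
  rewrite big_nil; apply: is_curve_integral_eq is_curve_integral0 => x _.
  by rewrite big_nil.
rewrite big_cons; apply: is_curve_integral_eq (is_curve_integralD (h j) ih) => x _.
by rewrite big_cons.
Qed.

(** The Riemann sums of [f] and [f'] differ by at most the uniform distance times a bound for the
    length of the curve. This yields the existence of the integral of [f] together with its
    value. *)
Lemma is_curve_integral_uniform f I : rectifiable g ->
  (forall e : R, 0 < e -> exists f' I', [/\ is_curve_integral g f' I',
     cabs (I' - I) <= e & forall x, curve g x -> cabs (f' x - f x) <= e]) ->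
  is_curve_integral g f I.
Proof.
move=> [M hM] h; apply/is_curve_integralP => e e0.
pose B := Num.max M 0.
have B0 : 0 <= B by rewrite le_max lexx orbT.
(* Replacing [f] by [f'] costs [B] times this quantity and replacing [I'] by [I] costs it once;
   together they make [e / 3]. *)
have e'0 : 0 < e / (3 * (B + 1)) by apply: divr_gt0 => //; lra.
have [f' [I' [/is_curve_integralP hI' II' ff']]] := h _ e'0.
have e3 : 0 < e / 3 by lra.
have [d d0 hd] := hI' _ e3; exists d => // s t st.
have eB : e / (3 * (B + 1)) * (B + 1) = e / 3 by field; lra.
rewrite (le_lt_trans (cabs_triangle _ (riemann_stieltjes_sum g f' s t) _)) //.
rewrite (le_lt_trans (lerD (lexx _) (cabs_triangle _ I' _))) //.
have : cabs (riemann_stieltjes_sum g f s t - riemann_stieltjes_sum g f' s t) <=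
   e / (3 * (B + 1)) * B.
  rewrite /riemann_stieltjes_sum -sumrB (le_trans (cabs_sum _ _ _)) //.
  have [ps _] := st.
  apply: (@le_trans _ _ (e / (3 * (B + 1)) * M)); last first.
    by rewrite ler_pM2l // le_max lexx.
  have := hM s ps.
  have -> : \sum_(k < size s)
    `|g (nth 1 (0 :: s) k.+1) - g (nth 1 (0 :: s) k)| =
   (\sum_(k < size s) cabs (g (nth 1 (0 :: s) k.+1) - g (nth 1 (0 :: s) k)))%:C.
    by rewrite rmorph_sum; apply: eq_bigr => k _; rewrite cabsE.
  rewrite lecR => hs; apply: le_trans (ler_wpM2l (ltW e'0) hs).
  rewrite mulr_sumr; apply: ler_sum => k _.
  rewrite -mulrBl cabsM ler_wpM2r ?cabs_ge0 // cabs_distC ff' //.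
  exact: tagged_partition_in st _.
have := hd s t st; nra.
Qed.

End CurveIntegral.

(** * Powers and winding numbers *)

Lemma eq_ler (R : numDomainType) (x y : R) : x = y -> x <= y.
Proof. by move=> ->. Qed.

Lemma expr_small (R : realType) (r K e : R) : 0 <= r < 1 -> 0 < e ->
  exists N : nat, forall n, (N <= n)%N -> K * r ^+ n < e.
Proof.
move=> /andP[r0 r1] e0.
have /cvg_expr : `|r| < 1 by rewrite ger0_norm.
have e1 : 0 < e / (`|K| + 1) by apply: divr_gt0 => //; rewrite ltr_wpDl.
move=> /cvgrPdist_lt /(_ _ e1) [N _ hN]; exists N => n /hN.
rewrite sub0r normrN ger0_norm ?exprn_ge0 // ltr_pdivlMr ?ltr_wpDl // => h.
have := exprn_ge0 n r0; have := ler_norm K; nra.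
Qed.

(** * Compactness of the curve and uniform continuity of its parametrisation *)

Section CurveTopology.
Variables (R : realType) (g : R -> R[i]).
Hypothesis cont_g : {within `[0, 1], continuous g}.

Lemma curve_compact : compact (curve g).
Proof. by apply: continuous_compact => //; exact: segment_compact. Qed.

Lemma curve_bounded : exists2 B : R, 1 <= B & forall x, curve g x -> cabs x <= B.
Proof.
have [M [_ hM]] : \forall M \near +oo%R, curve g `<=` (fun x => cabs x <= M).
  move/compact_near_coveringP: curve_compact; apply => x _.
  exists ([set y | cabs (y - x) < 1], [set M | cabs x + 1 < M]).
    split=> /=; last by exists (cabs x + 1); split => //; exact: num_real.
    by apply/nbhs_cabsP; exists 1.
  move=> [y M] /= [xy yM]; have := cabsD (y - x) x; rewrite subrK; lra.
exists (Num.max 1 (M + 1)); first by rewrite le_max lexx.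
by move=> x; apply: hM; rewrite lt_max ltrDl ltr01 orbT.
Qed.

Lemma curve_dist p : ~ curve g p ->
  exists2 e : R, 0 < e & forall x, curve g x -> e <= cabs (x - p).
Proof.
move=> np.
have /closed_openC/open_cabsP/(_ p np)[e e0 he] : closed (curve g).
  apply: compact_closed; first exact: (@norm_hausdorff R[i] R[i]).
  exact: curve_compact.
by exists e => // x cx; rewrite leNgt; apply/negP => /he.
Qed.

(** Heine-Cantor: compactness in near-covering form, applied to the filter of small positive [d],
    makes the local moduli of continuity uniform. *)
Lemma curve_uniform (e : R) : 0 < e -> exists2 d : R, 0 < d & forall s t,
  0 <= s <= 1 -> 0 <= t <= 1 -> `|s - t| < d -> cabs (g s - g t) < e.
Proof.
move=> e0.
have /compact_near_coveringP : compact `[0, 1 : R] by exact: segment_compact.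
(* Membership of [s] in the segment is repeated inside the predicate: the covering condition ranges
   over a full neighbourhood, while [g] is continuous only within the segment. *)
move=> /(_ R (0^'+) (fun d s => forall t,
  0 <= t <= 1 -> `|s - t| < d -> 0 <= s <= 1 -> cabs (g s - g t) < e)) h.
suff [d /= d0 hd] : \forall d \near 0^'+, `[0, 1] `<=` (fun s => forall t,
  0 <= t <= 1 -> `|s - t| < d -> 0 <= s <= 1 -> cabs (g s - g t) < e).
  exists (d / 2) => [|s t s01 t01 st]; first lra.
  have d2 : 0 < d / 2 by lra.
  have bd : `|0 - d / 2| < d by rewrite sub0r normrN gtr0_norm //; lra.
  by apply: (hd _ bd d2 s _ t t01 st s01); rewrite /= in_itv.
apply: h => s /=; rewrite in_itv /= => s01.
have e20 : 0 < e / 2 by lra.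
have s01' : `[0, 1]%classic s by rewrite /= in_itv.
have /subspace_continuousP/(_ s s01') hs := cont_g.
have /hs : nbhs (g s) [set y | cabs (y - g s) < e / 2] by apply/nbhs_cabsP; exists (e / 2).
move=> /nbhs_ballP[d /= d0 hd].
exists ([set s' | `|s - s'| < d / 2], [set d' | d' < d / 2]).
  split=> /=.
    by apply/nbhs_ballP; exists (d / 2) => //=; lra.
  by exists (d / 2) => /=; [lra|move=> y /=; rewrite sub0r normrN => /ltr_normlP[]; lra].
move=> [s' d'] /= [ss' d'd] t t01 s't s'01.
have h1 : cabs (g s' - g s) < e / 2.
  by apply: hd; rewrite /ball /= ?in_itv //; lra.
have h2 : cabs (g t - g s) < e / 2.
  apply: hd; rewrite /ball /= ?in_itv //.
  have := ler_distD s' s t; lra.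
have := cabs_triangle (g s') (g s) (g t); rewrite (cabs_distC (g s) (g t)); lra.
Qed.

End CurveTopology.

(** * Primitives, integer powers, and the vanishing winding number outside *)

Section Primitives.
Variables (R : realType) (g : R -> R[i]).
Hypotheses (cont_g : {within `[0, 1], continuous g}) (closed_g : g 0 = g 1)
  (rect_g : rectifiable g).

(** The increments of [F] telescope to [F (g 1) - F (g 0) = 0], and each differs from its term of
    the Riemann sum by at most a small multiple of the chord; the chords add up to at most [M]. Only
    differences between points of the curve enter, so no complex derivative is involved. *)
Lemma is_curve_integral_primitive F f :
  (forall e : R, 0 < e -> exists2 d : R, 0 < d & forall x y z,
     curve g x -> curve g y -> curve g z -> cabs (x - z) < d -> cabs (y - z) < d ->
     cabs (F y - F x - f z * (y - x)) <= e * cabs (y - x)) ->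
  is_curve_integral g f 0.
Proof.
move=> h; apply/is_curve_integralP => e e0.
have [M hM] := rect_g.
pose B := Num.max M 0.
have B0 : 0 <= B by rewrite le_max lexx orbT.
have [|d1 d10 hd1] := h (e / (B + 1)); first by apply: divr_gt0 => //; lra.
have [d d0 hd] := curve_uniform cont_g d10.
exists d => // s t [ps hst]; rewrite subr0.
have tele : \sum_(k < size s) (F (g (nth 1 (0 :: s) k.+1)) - F (g (nth 1 (0 :: s) k))) = 0.
  rewrite -(big_mkord xpredT (fun k => F (g (nth 1 (0 :: s) k.+1)) - F (g (nth 1 (0 :: s) k)))).
  rewrite telescope_sumr // (itv_partition_nth_size _ ps) /=.
  by rewrite closed_g subrr.
rewrite -cabsN -[X in cabs X]add0r -{}tele -sumrB.
rewrite (le_lt_trans (cabs_sum _ _ _)) //.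
apply: (@le_lt_trans _ _ (\sum_(k < size s) e / (B + 1) *
    cabs (g (nth 1 (0 :: s) k.+1) - g (nth 1 (0 :: s) k)))).
  apply: ler_sum => k _.
  have [/andP[h1 h2] h3] := hst k (ltn_ord k).
  have i1 : 0 <= nth 1 (0 :: s) k <= 1.
    have k1 : (k < (size s).+1)%N by rewrite ltnS ltnW.
    by rewrite (itv_partition_nth_ge k1 ps) (itv_partition_nth_le k1 ps).
  have i2 : 0 <= nth 1 (0 :: s) k.+1 <= 1.
    have k1 : (k.+1 < (size s).+1)%N by rewrite ltnS.
    by rewrite (itv_partition_nth_ge k1 ps) (itv_partition_nth_le k1 ps).
  have i3 : 0 <= t k <= 1 by lra.
  apply: hd1.
  - by exists (nth 1 (0 :: s) k) => //=; rewrite in_itv.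
  - by exists (nth 1 (0 :: s) k.+1) => //=; rewrite in_itv.
  - by exists (t k) => //=; rewrite in_itv.
  - by apply: hd => //; rewrite ltr_norml; lra.
  - by apply: hd => //; rewrite ltr_norml; lra.
rewrite -mulr_sumr.
have := hM s ps.
have -> : \sum_(k < size s)
    `|g (nth 1 (0 :: s) k.+1) - g (nth 1 (0 :: s) k)| =
   (\sum_(k < size s) cabs (g (nth 1 (0 :: s) k.+1) - g (nth 1 (0 :: s) k)))%:C.
  by rewrite rmorph_sum; apply: eq_bigr => k _; rewrite cabsE.
rewrite lecR; set S := \sum_(k < _) _ => SM.
have MB : M <= B by rewrite le_max lexx.
have e'0 : 0 < e / (B + 1) by apply: divr_gt0 => //; lra.
have eB : e / (B + 1) * (B + 1) = e by field; lra.
nra.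
Qed.

(** Since [1 <= B], the exponent [n] may replace the sharper [n - 1], which keeps predecessors out
    of the induction. *)
Lemma cabs_pow_diff (B : R) (y z : R[i]) n : 1 <= B -> cabs y <= B -> cabs z <= B ->
  cabs (y ^+ n - z ^+ n) <= n%:R * B ^+ n * cabs (y - z).
Proof.
move=> B1 yB zB; elim: n => [|n ih].
  by rewrite !expr0 subrr cabs0 !mul0r.
have -> : y ^+ n.+1 - z ^+ n.+1 = y * (y ^+ n - z ^+ n) + (y - z) * z ^+ n.
  by rewrite !exprS; ring.
rewrite (le_trans (cabsD _ _)) // !cabsM cabsX.
have zn : cabs z ^+ n <= B ^+ n by apply: lerXn2r => //; rewrite ?nnegrE ?cabs_ge0 //; lra.
have Bn : 1 <= B ^+ n by rewrite exprn_ege1.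
have yz := cabs_ge0 (y - z).
have yn := cabs_ge0 y.
have h1 : cabs y * cabs (y ^+ n - z ^+ n) <= B * (n%:R * B ^+ n * cabs (y - z)).
  by apply: ler_pM => //; exact: cabs_ge0.
have h2 : cabs (y - z) * cabs z ^+ n <= B * (B ^+ n * cabs (y - z)).
  have k1 : cabs (y - z) * cabs z ^+ n <= cabs (y - z) * B ^+ n by apply: ler_wpM2l.
  have k2 : 0 <= B ^+ n * cabs (y - z) by apply: mulr_ge0 => //; lra.
  nra.
rewrite (le_trans (lerD h1 h2)) // exprS -natr1; apply: eq_ler; ring.
Qed.

Lemma cabs_monomial_diff (B : R) (x y z : R[i]) a b : 1 <= B ->
  cabs x <= B -> cabs y <= B -> cabs z <= B ->
  cabs (y ^+ a * x ^+ b - z ^+ (a + b)) <=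
    (a + b)%:R * B ^+ (a + b) * (cabs (y - z) + cabs (x - z)).
Proof.
move=> B1 xB yB zB.
have -> : y ^+ a * x ^+ b - z ^+ (a + b) =
   (y ^+ a - z ^+ a) * x ^+ b + z ^+ a * (x ^+ b - z ^+ b).
  by rewrite exprD; ring.
rewrite (le_trans (cabsD _ _)) // !cabsM !cabsX.
have nn := @nnegrE R.
have xb : cabs x ^+ b <= B ^+ b by apply: lerXn2r; rewrite ?nn ?cabs_ge0 //; lra.
have za : cabs z ^+ a <= B ^+ a by apply: lerXn2r; rewrite ?nn ?cabs_ge0 //; lra.
have h1 := cabs_pow_diff a B1 yB zB.
have h2 := cabs_pow_diff b B1 xB zB.
have yz := cabs_ge0 (y - z); have xz := cabs_ge0 (x - z).
have h3 : cabs (y ^+ a - z ^+ a) * cabs x ^+ b <=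
   (a%:R * B ^+ a * cabs (y - z)) * B ^+ b.
  by apply: ler_pM => //; rewrite ?exprn_ge0 ?cabs_ge0.
have h4 : cabs z ^+ a * cabs (x ^+ b - z ^+ b) <=
   B ^+ a * (b%:R * B ^+ b * cabs (x - z)).
  by apply: ler_pM => //; rewrite ?exprn_ge0 ?cabs_ge0.
rewrite (le_trans (lerD h3 h4)) //.
rewrite exprD natrD.
have a0 : 0 <= a%:R :> R by []. have b0 : 0 <= b%:R :> R by [].
have Ba : 0 <= B ^+ a * B ^+ b by apply: mulr_ge0; apply: exprn_ge0; lra.
have p1 : 0 <= a%:R * (B ^+ a * B ^+ b) * cabs (x - z) by apply: mulr_ge0 => //; exact: mulr_ge0.
have p2 : 0 <= b%:R * (B ^+ a * B ^+ b) * cabs (y - z) by apply: mulr_ge0 => //; exact: mulr_ge0.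
rewrite -subr_ge0.
have -> : (a%:R + b%:R) * (B ^+ a * B ^+ b) * (cabs (y - z) + cabs (x - z)) -
  (a%:R * B ^+ a * cabs (y - z) * B ^+ b + B ^+ a * (b%:R * B ^+ b * cabs (x - z))) =
  a%:R * (B ^+ a * B ^+ b) * cabs (x - z) + b%:R * (B ^+ a * B ^+ b) * cabs (y - z).
  by ring.
exact: addr_ge0.
Qed.

(* The hypothesis on F is the factorisation of a difference of powers of h;
   it covers h x = x - p as well as h x = (x - p)^-1. *)
Lemma is_curve_integral_power (h F : R[i] -> R[i]) (B L : R) (n m : nat)
    (a b : nat -> nat) :
  1 <= B -> (forall x, curve g x -> cabs (h x) <= B) ->
  0 <= L -> (forall x y, curve g x -> curve g y -> cabs (h x - h y) <= L * cabs (x - y)) ->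
  (0 < n)%N -> (forall i, (i < n)%N -> a i + b i = m)%N ->
  (forall x y, curve g x -> curve g y ->
     n%:R * (F y - F x) = (y - x) * \sum_(i < n) h y ^+ a i * h x ^+ b i) ->
  is_curve_integral g (fun x => h x ^+ m) 0.
Proof.
move=> B1 hB L0 hL n0 hab hF.
apply: (@is_curve_integral_primitive F) => e e0.
(* [m%:R * B ^+ m] comes from the comparison of monomials, and each of the two distances to [h z]
   contributes one [L]. *)
pose K := m%:R * B ^+ m * (L + L).
have K0 : 0 <= K.
  by apply: mulr_ge0; [apply: mulr_ge0; [|apply: exprn_ge0; lra]|lra].
exists (e / (K + 1)); first by apply: divr_gt0 => //; lra.
move=> x y z cx cy cz xz yz.
have nR : 0 < n%:R :> R by rewrite ltr0n.
have nC : n%:R != 0 :> R[i] by rewrite pnatr_eq0 -lt0n.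
rewrite -(ler_pM2l nR).
(* After multiplication by [n], the [n] copies of [h z ^+ m] are distributed over the [n] terms of
   the factorisation, so each monomial is compared with [h z ^+ m] separately. *)
have -> : n%:R * cabs (F y - F x - h z ^+ m * (y - x)) =
   cabs (\sum_(i < n) (h y ^+ a i * h x ^+ b i - h z ^+ m)) * cabs (y - x).
  have -> : (n%:R : R) = cabs n%:R.
    by apply: complexI; rewrite -cabsE ger0_norm ?ler0n // rmorph_nat.
  rewrite -!cabsM; congr cabs.
  rewrite sumrB sumr_const card_ord mulrBr hF // -mulr_natl; ring.
rewrite mulrA ler_wpM2r ?cabs_ge0 //.
rewrite (le_trans (cabs_sum _ _ _)) //.
apply: (@le_trans _ _ (\sum_(i < n) e)); last first.
  by apply: eq_ler; rewrite sumr_const card_ord mulr_natl.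
apply: ler_sum => i _.
have := cabs_monomial_diff (a i) (b i) B1 (hB x cx) (hB y cy) (hB z cz).
rewrite hab //.
have := hL x z cx cz; have := hL y z cy cz => h1 h2 h3.
apply: (le_trans h3).
have eK : e / (K + 1) * (K + 1) = e by field; lra.
have d0 : 0 < e / (K + 1) by apply: divr_gt0 => //; lra.
have h4 : cabs (h y - h z) + cabs (h x - h z) <= (L + L) * (e / (K + 1)) by nra.
have mB : 0 <= m%:R * B ^+ m by apply: mulr_ge0 => //; apply: exprn_ge0; lra.
apply: (le_trans (ler_wpM2l mB h4)).
have -> : m%:R * B ^+ m * ((L + L) * (e / (K + 1))) = K * (e / (K + 1)) by rewrite /K; ring.
lra.
Qed.

Lemma is_curve_integral_pos_power p n :
  is_curve_integral g (fun x => (x - p) ^+ n) 0.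
Proof.
have [B B1 hB] := curve_bounded cont_g.
have pp := cabs_ge0 p.
(* The factorisation used is that of [Y ^+ n.+1 - X ^+ n.+1] by [Y - X], whose terms are
   [Y ^+ (n - i) * X ^+ i]. *)
apply: (@is_curve_integral_power (fun x => x - p)
   (fun x => n.+1%:R^-1 * (x - p) ^+ n.+1)
   (B + cabs p) 1 n.+1 n (fun i => n - i)%N (fun i => i)) => //.
- by lra.
- by move=> x /hB xB; rewrite (le_trans (cabsB _ _)) // lerD2r.
- by move=> x y _ _; rewrite mul1r; apply: eq_ler; congr cabs; ring.
- by move=> i; rewrite ltnS => /subnK.
move=> x y _ _.
by rewrite -mulrBr mulVKf ?pnatr_eq0 // subrXX; congr (_ * _); ring.
Qed.

Lemma is_curve_integral_neg_power p n : ~ curve g p ->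
  is_curve_integral g (fun x => (x - p)^-1 ^+ n.+2) 0.
Proof.
move=> np; have [d d0 hd] := curve_dist cont_g np.
have xp x : curve g x -> x - p != 0.
  by move=> /hd; rewrite -cabs_gt0; lra.
have hV x : curve g x -> cabs (x - p)^-1 <= d^-1.
  move=> cx; rewrite cabsV lef_pV2 ?posrE ?hd // cabs_gt0; exact: xp.
have di : 0 < d^-1 by rewrite invr_gt0.
(* The difference of the reciprocals [h x - h y] equals [(y - x) * h x * h y]: this gives the
   Lipschitz constant and raises both exponents of every term by one. The summand 1 in [d^-1 + 1]
   only secures a bound that is at least 1. *)
apply: (@is_curve_integral_power (fun x => (x - p)^-1)
   (fun x => - n.+1%:R^-1 * (x - p)^-1 ^+ n.+1)
   (d^-1 + 1) (d^-1 * d^-1) n.+1 n.+2 (fun i => i.+1)%N (fun i => (n - i).+1)) => //.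
- by lra.
- by move=> x /hV; lra.
- by rewrite mulr_ge0 // ltW.
- move=> x y cx cy.
  have -> : (x - p)^-1 - (y - p)^-1 = (x - p)^-1 * (y - p)^-1 * (y - x).
    by field; rewrite !xp.
  rewrite !cabsM (cabs_distC y) ler_wpM2r ?cabs_ge0 //.
  by apply: ler_pM; rewrite ?cabs_ge0 ?hV.
- by move=> i; rewrite ltnS addSn addnS => /subnKC ->.
move=> x y cx cy.
have -> : n.+1%:R * (- n.+1%:R^-1 * (y - p)^-1 ^+ n.+1 - - n.+1%:R^-1 * (x - p)^-1 ^+ n.+1) =
   (x - p)^-1 ^+ n.+1 - (y - p)^-1 ^+ n.+1.
  by rewrite !mulNr opprK addrC -mulrBr mulVKf ?pnatr_eq0.
rewrite subrXX.
have -> : (x - p)^-1 - (y - p)^-1 = (y - x) * ((x - p)^-1 * (y - p)^-1).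
  by field; rewrite !xp.
rewrite -mulrA mulr_sumr; congr (_ * _); apply: eq_bigr => i _ /=.
rewrite !exprS; ring.
Qed.

(** The expansion of [1 / (al - be)] in powers of [be / al] converges uniformly on the curve, the
    ratio being at most 1/2 in modulus. Moving [p] slightly and sending [p] far away are both
    instances. *)
Lemma is_curve_integral_geometric (al be : R[i] -> R[i]) (c : R) : 0 < c ->
  (forall x, curve g x -> c <= cabs (al x)) ->
  (forall x, curve g x -> cabs (be x) <= cabs (al x) / 2) ->
  (forall n, is_curve_integral g (fun x => be x ^+ n * (al x)^-1 ^+ n.+1) 0) ->
  is_curve_integral g (fun x => (al x - be x)^-1) 0.
Proof.
move=> c0 hal hbe hint; apply: is_curve_integral_uniform => // e e0.
have [|N hN] := @expr_small R (1 / 2) (2 / c) e _ e0; first lra.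
exists (fun x => \sum_(n <- iota 0 N) be x ^+ n * (al x)^-1 ^+ n.+1).
exists (\sum_(n <- iota 0 N) 0); split; first exact: is_curve_integral_sum.
  by rewrite big1 // subrr cabs0 ltW.
move=> x cx; have a1 := hal x cx; have b1 := hbe x cx.
have a0 : al x != 0 by rewrite -cabs_gt0; lra.
have ab1 : cabs (al x) / 2 <= cabs (al x - be x).
  by have := cabs_sub_ge (al x) (be x); lra.
have ab0 : al x - be x != 0 by rewrite -cabs_gt0; lra.
(* The remainder after [N] terms; it is at most [2 / c] times the [N]-th power of 1/2, because
   [al - be] has modulus at least [c / 2]. *)
have -> : \sum_(n <- iota 0 N) be x ^+ n * (al x)^-1 ^+ n.+1 - (al x - be x)^-1 =
   - ((be x / al x) ^+ N / (al x - be x)).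
  elim: N {hN} => [|N ih]; first by rewrite big_nil expr0 mul1r sub0r.
  rewrite -addn1 iotaD big_cat big_seq1 add0n addrAC ih addn1 !exprS !expr_div_n !exprVn.
  by field; rewrite ab0 a0 expf_neq0.
rewrite cabsN !cabsM cabsX cabsM !cabsV.
apply: ltW; apply: le_lt_trans (hN N (leqnn N)).
rewrite mulrC; apply: ler_pM; rewrite ?exprn_ge0 ?mulr_ge0 ?invr_ge0 ?cabs_ge0 //.
- rewrite -[2 / c]invf_div lef_pV2 ?posrE; lra.
- apply: lerXn2r; rewrite ?nnegrE ?mulr_ge0 ?invr_ge0 ?cabs_ge0 //.
  rewrite ler_pdivrMr; lra.
Qed.

(** Inside the component [A] of [p], the set [Z] is open and closed, and it is not empty because the
    unbounded [A] leaves the disc of radius [2 * B]. Connectedness gives that [Z] contains [A]. *)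
Lemma is_curve_integral_exterior p : curve_exterior g p ->
  is_curve_integral g (fun x => (x - p)^-1) 0.
Proof.
move=> [np unb].
pose Z := [set p | ~ curve g p /\ is_curve_integral g (fun x => (x - p)^-1) 0].
have [B B1 hB] := curve_bounded cont_g.
(* Expansion in powers of [(p2 - p1) / (x - p1)]: the terms of order at least two have primitives,
   and the first is the hypothesis on [p1]. *)
have near p1 p2 (e : R) : 0 < e -> (forall x, curve g x -> e <= cabs (x - p1)) ->
  cabs (p2 - p1) <= e / 2 -> Z p1 -> Z p2.
  move=> e0 he p12 [np1 hp1]; split.
    by move=> /he; lra.
  apply: is_curve_integral_eq (@is_curve_integral_geometric (fun x => x - p1)
     (fun=> p2 - p1) e e0 he _ _) => [x cx|x cx|[|n]].
  - by congr (_^-1); ring.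
  - have := he x cx; lra.
  - by apply: is_curve_integral_eq hp1 => x _; rewrite mul1r expr1.
  - rewrite -(mulr0 ((p2 - p1) ^+ n.+1)); apply: is_curve_integralZ.
    exact: is_curve_integral_neg_power.
(* Expansion in powers of [x / p1]: every term is a polynomial in [x] and has a primitive. *)
have far p1 : 2 * B < cabs p1 -> Z p1.
  move=> p1B; have np1 : ~ curve g p1 by move=> /hB; lra.
  have p10 : p1 != 0 by rewrite -cabs_gt0; lra.
  split=> //.
  apply: is_curve_integral_eq (@is_curve_integral_geometric (fun=> - p1)
     (fun x => - x) 1 _ _ _ _) => [x cx| //|x _|x cx|n].
  - by congr (_^-1); ring.
  - by rewrite cabsN; lra.
  - by rewrite !cabsN; have := hB x cx; lra.
  - have := is_curve_integralZ ((-1) ^+ n * (- p1)^-1 ^+ n.+1)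
      (is_curve_integral_pos_power 0 n).
    rewrite mulr0; apply: is_curve_integral_eq => x _.
    by rewrite subr0 -[- x]mulN1r [in RHS]exprMn; ring.
pose A := connected_component (~` curve g) p.
have Ap : A p by apply: connected_component_refl.
have AC : A `<=` ~` curve g by apply: connected_component_sub.
have [p1 [Ap1 p1B]] : exists p1, A p1 /\ 2 * B < cabs p1.
  apply/not_existsP => hno; apply: unb; exists (2 * B)%:C; split.
    by apply/complex_realP; exists (2 * B).
  move=> M BM x Ax; have : cabs x <= 2 * B.
    by rewrite leNgt; apply/negP => h; exact: (hno x).
  by rewrite -lecR -cabsE => h; exact: le_trans h (ltW BM).
have AcA : connected A by apply: component_connected.
suff : A `&` Z = A by move=> /seteqP[_ /(_ p Ap)[_ []]].
apply: AcA.
- by exists p1; split => //; exact: far.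
- exists Z => //; apply/open_cabsP => x Zx.
  have [e e0 he] := curve_dist cont_g (proj1 Zx).
  exists (e / 2) => [|y yx]; first lra.
  by apply: near he (ltW yx) Zx.
(* This closed set is the union of the curve and [Z]; [Z] is closed only relative to the complement
   of the curve, and [A] does not meet the curve. *)
- exists (~` (~` curve g `&` ~` Z)); last first.
    apply/seteqP; split => x [Ax]; first by move=> Zx; split => // -[].
    by move=> h; split => //; apply: contrapT => nZ; apply: h; split => //; exact: AC.
  apply: open_closedC; apply/open_cabsP => x [cx nZ].
  have [e e0 he] := curve_dist cont_g cx.
  (* The curve stays at distance [2 * e / 3] from [y], and [x] lies within half of that, so [near]
     leads from [y] back to [x]. *)
  exists (e / 3) => [|y yx]; first lra.
  have hy z : curve g z -> 2 * e / 3 <= cabs (z - y).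
    by move=> /he; have := cabs_triangle z y x; lra.
  split; first by move=> /he; lra.
  move=> Zy; apply: nZ; apply: near hy _ Zy; first lra.
  rewrite cabs_distC; lra.
Qed.

End Primitives.

(** * Uniform convergence and infinite products *)

Definition qpochn (R : realType) (n : nat) (y q : R[i]) : R[i] :=
  \prod_(j < n) (1 - y * q ^+ j).

Definition ucvg (R : realType) (T : Type) (K : set T) (F : nat -> T -> R[i])
    (f : T -> R[i]) : Prop :=
  forall e : R, 0 < e -> exists N : nat, forall n, (N <= n)%N ->
    forall x, K x -> cabs (F n x - f x) <= e.

Definition ubounded (R : realType) (T : Type) (K : set T) (f : T -> R[i]) : Prop :=
  exists M : R, forall x, K x -> cabs (f x) <= M.

(** A uniform lower bound, as needed to invert a uniform limit; pointwise non-vanishing would not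
    suffice. *)
Definition away0 (R : realType) (T : Type) (K : set T) (f : T -> R[i]) : Prop :=
  exists2 m : R, 0 < m & forall x, K x -> m <= cabs (f x).

Section UniformConvergence.
Variables (R : realType) (T : Type) (K : set T).
Implicit Types (f h : T -> R[i]) (F H : nat -> T -> R[i]).

Lemma ucvg_cst f : ucvg K (fun=> f) f.
Proof. by move=> e e0; exists 0%N => n _ x _; rewrite subrr cabs0 ltW. Qed.

Lemma ucvg_eq F H f h : (forall n x, K x -> F n x = H n x) ->
  (forall x, K x -> f x = h x) -> ucvg K F f -> ucvg K H h.
Proof.
move=> FH fh hF e e0; have [N hN] := hF e e0; exists N => n Nn x Kx.
by rewrite -FH // -fh // hN.
Qed.

Lemma ucvg_ubounded F f : ubounded K f -> ucvg K F f ->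
  exists M : R, exists N : nat, 0 <= M /\
    forall n, (N <= n)%N -> forall x, K x -> cabs (F n x) <= M.
Proof.
move=> [M hM] /(_ 1 ltr01)[N hN]; exists (Num.max 0 (M + 1)), N; split.
  by rewrite le_max lexx.
move=> n Nn x Kx; rewrite le_max; apply/orP; right.
have := cabsD (F n x - f x) (f x); rewrite subrK.
have := hN n Nn x Kx; have := hM x Kx; lra.
Qed.

Lemma uboundedM f h : ubounded K f -> ubounded K h -> ubounded K (fun x => f x * h x).
Proof.
move=> [M hM] [M' hM']; exists (M * M') => x Kx; rewrite cabsM.
by apply: ler_pM; rewrite ?cabs_ge0 ?hM ?hM'.
Qed.

Lemma uboundedB f h : ubounded K f -> ubounded K h -> ubounded K (fun x => f x - h x).
Proof.
move=> [M hM] [M' hM']; exists (M + M') => x Kx.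
by rewrite (le_trans (cabsB _ _)) // lerD ?hM ?hM'.
Qed.

Lemma ubounded_cst (c : R[i]) : ubounded K (fun=> c).
Proof. by exists (cabs c). Qed.

Lemma away0_ubounded f : away0 K f -> ubounded K (fun x => (f x)^-1).
Proof.
move=> [m m0 hm]; exists m^-1 => x Kx; rewrite cabsV lef_pV2 ?posrE ?hm //.
exact: lt_le_trans (hm x Kx).
Qed.

Lemma away0M f h : away0 K f -> away0 K h -> away0 K (fun x => f x * h x).
Proof.
move=> [m m0 hm] [m' m'0 hm']; exists (m * m') => [|x Kx]; first exact: mulr_gt0.
by rewrite cabsM; apply: ler_pM; rewrite ?hm ?hm' // ltW.
Qed.

Lemma away0_neq0 f x : away0 K f -> K x -> f x != 0.
Proof. by move=> [m m0 hm] Kx; rewrite -cabs_gt0; exact: lt_le_trans (hm x Kx). Qed.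

Lemma ucvgM F H f h : ubounded K f -> ubounded K h ->
  ucvg K F f -> ucvg K H h -> ucvg K (fun n x => F n x * H n x) (fun x => f x * h x).
Proof.
move=> bf [M' hM'] cF cH e e0.
have [M [N1 [M0 hM]]] := ucvg_ubounded bf cF.
pose S := M + Num.max 0 M' + 1.
have M'0 : 0 <= Num.max 0 M' by rewrite le_max lexx.
have S0 : 0 < S by rewrite /S; lra.
have eS : 0 < e / S by apply: divr_gt0.
have [N2 hN2] := cF _ eS; have [N3 hN3] := cH _ eS.
exists (maxn N1 (maxn N2 N3)) => n; rewrite !geq_max => /and3P[n1 n2 n3] x Kx.
have -> : F n x * H n x - f x * h x = F n x * (H n x - h x) + (F n x - f x) * h x by ring.
rewrite (le_trans (cabsD _ _)) // !cabsM.
have a1 := hM n n1 x Kx; have a2 := hN2 n n2 x Kx; have a3 := hN3 n n3 x Kx.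
have a4 : cabs (h x) <= Num.max 0 M' by rewrite le_max hM' ?orbT.
have eSS : e / S * S = e by field; lra.
have b1 : cabs (F n x) * cabs (H n x - h x) <= M * (e / S).
  by apply: ler_pM; rewrite ?cabs_ge0.
have b2 : cabs (F n x - f x) * cabs (h x) <= e / S * Num.max 0 M'.
  by apply: ler_pM; rewrite ?cabs_ge0.
rewrite (le_trans (lerD b1 b2)) //.
by rewrite -[leRHS]eSS /S; nra.
Qed.

Lemma ucvgB F H f h : ucvg K F f -> ucvg K H h ->
  ucvg K (fun n x => F n x - H n x) (fun x => f x - h x).
Proof.
move=> cF cH e e0; have e2 : 0 < e / 2 by lra.
have [N2 hN2] := cF _ e2; have [N3 hN3] := cH _ e2.
exists (maxn N2 N3) => n; rewrite !geq_max => /andP[n2 n3] x Kx.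
have -> : F n x - H n x - (f x - h x) = (F n x - f x) - (H n x - h x) by ring.
rewrite (le_trans (cabsB _ _)) //.
have := hN2 n n2 x Kx; have := hN3 n n3 x Kx; lra.
Qed.

Lemma ucvgV F f : away0 K f -> ucvg K F f ->
  ucvg K (fun n x => (F n x)^-1) (fun x => (f x)^-1).
Proof.
move=> [m m0 hm] cF e e0.
have m2 : 0 < m / 2 by lra.
have [N1 hN1] := cF _ m2.
(* Eventually [F n x] has modulus at least [m / 2], so the denominator [f x * F n x] of the
   difference of inverses is at least [m * m / 2]. *)
have em : 0 < e * (m * m / 2) by apply: mulr_gt0 => //; nra.
have [N2 hN2] := cF _ em.
exists (maxn N1 N2) => n; rewrite !geq_max => /andP[n1 n2] x Kx.
have a1 := hN1 n n1 x Kx; have a2 := hN2 n n2 x Kx; have a3 := hm x Kx.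
have a4 : m / 2 <= cabs (F n x).
  by have := cabs_sub_ge (f x) (f x - F n x); rewrite subKr cabs_distC; lra.
have f0 : f x != 0 by rewrite -cabs_gt0; lra.
have F0 : F n x != 0 by rewrite -cabs_gt0; lra.
have -> : (F n x)^-1 - (f x)^-1 = (f x - F n x) / (f x * F n x).
  by field; rewrite f0 F0.
rewrite cabsM cabsV cabsM cabs_distC ler_pdivrMr; last by apply: mulr_gt0; lra.
apply: (le_trans a2); apply: ler_wpM2l; first exact: ltW.
have : m * (m / 2) <= cabs (f x) * cabs (F n x) by apply: ler_pM; lra.
lra.
Qed.

End UniformConvergence.

Lemma cabs_le_eq (R : realType) (x y : R[i]) :
  (forall e : R, 0 < e -> cabs (x - y) <= e) -> x = y.
Proof.
move=> h; apply/eqP; rewrite -subr_eq0 -cabs_eq0 eq_le cabs_ge0 andbT.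
by apply/ler_addgt0Pr => e /h; rewrite add0r.
Qed.

(** Completeness is taken from [R]: the real and imaginary parts are bounded by the modulus, hence
    are Cauchy sequences. *)
Lemma cvg_geometric (R : realType) (u : nat -> R[i]) (C r : R) : 0 <= r < 1 ->
  (forall n k, cabs (u (n + k)%N - u n) <= C * r ^+ n) -> cvg (u @ \oo).
Proof.
move=> r01 hu.
have real_cvg (v : nat -> R) : (forall n k, `|v (n + k)%N - v n| <= C * r ^+ n) ->
    exists l, forall e, 0 < e -> exists N : nat, forall n, (N <= n)%N -> `|v n - l| < e.
  move=> hv; have : cvg (v @ \oo).
    apply: cauchy_cvg; apply/cauchy_exP => e e0.
    have [N hN] := expr_small C r01 e0; exists (v N); exists N => // n /= Nn.
    rewrite /ball /= distrC -(subnKC Nn).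
    exact: le_lt_trans (hv _ _) (hN _ (leqnn _)).
  move=> /cvg_ex[l /cvgrPdist_lt hl]; exists l => e /hl[N _ hN].
  by exists N => n /hN; rewrite /= distrC.
have Re_le (z : R[i]) : `|complex.Re z| <= cabs z.
  by rewrite -lecR -cabsE normc_ge_Re.
have Im_le (z : R[i]) : `|complex.Im z| <= cabs z.
  have := Re_le (z * 'i%C); rewrite ReiNIm normrN => h.
  apply: (le_trans h); rewrite cabsM.
  have -> : cabs ('i%C : R[i]) = 1.
    by apply: complexI; rewrite -cabsE normc_def /= expr0n /= add0r expr1n sqrtr1.
  by rewrite mulr1.
have ReB (z w : R[i]) : complex.Re (z - w) = complex.Re z - complex.Re w by case: z w => [? ?] [].
have ImB (z w : R[i]) : complex.Im (z - w) = complex.Im z - complex.Im w by case: z w => [? ?] [].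
have [|l1 h1] := real_cvg (fun n => complex.Re (u n)).
  by move=> n k; rewrite -ReB; exact: le_trans (hu n k).
have [|l2 h2] := real_cvg (fun n => complex.Im (u n)).
  by move=> n k; rewrite -ImB; exact: le_trans (hu n k).
apply/cvg_ex; exists (l1 +i* l2); apply/cvg_cabsP => e e0.
have e2 : 0 < e / 2 by lra.
have [N1 hN1] := h1 _ e2; have [N2 hN2] := h2 _ e2.
exists (maxn N1 N2) => n; rewrite geq_max => /andP[/hN1 n1 /hN2 n2].
have cabs_le (z : R[i]) : cabs z <= `|complex.Re z| + `|complex.Im z|.
  have creal (t : R) : cabs t%:C = `|t|.
    by rewrite /cabs normc_def /= expr0n /= addr0 sqrtr_sqr.
  rewrite {1}[z]complexE (le_trans (cabsD _ _)) // cabsM !creal lerD2l.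
  by rewrite /cabs normc_def /= expr0n /= add0r expr1n sqrtr1 mul1r.
by apply: (le_lt_trans (cabs_le _)); rewrite ReB ImB /=; lra.
Qed.

(** * Infinite q-products: convergence, bounds and functional equation *)

Section QProducts.
Variables (R : realType) (q : R[i]).
Hypothesis q1 : cabs q < 1.
Local Notation r := (cabs q).

Let r01 : 0 <= r < 1. Proof. by rewrite cabs_ge0. Qed.

Lemma qpochnS n y : qpochn n.+1 y q = qpochn n y q * (1 - y * q ^+ n).
Proof. by rewrite /qpochn big_ord_recr. Qed.

Lemma qpochnSl n y : qpochn n.+1 y q = (1 - y) * qpochn n (y * q) q.
Proof.
rewrite /qpochn big_ord_recl expr0 mulr1; congr (_ * _).
by apply: eq_bigr => i _; rewrite /= exprS mulrA.
Qed.

Lemma qpochnD n m y : qpochn (n + m) y q = qpochn n y q * qpochn m (y * q ^+ n) q.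
Proof.
elim: m => [|m ih]; first by rewrite addn0 /qpochn big_ord0 mulr1.
by rewrite addnS !qpochnS ih exprD !mulrA.
Qed.

(** Each factor is at most [expR (B * r ^+ j)]; the induction carries the exact partial sum of this
    geometric series, which is then bounded by the full sum. *)
Lemma qpochn_bound (B : R) n y : cabs y <= B ->
  cabs (qpochn n y q) <= expR (B / (1 - r)).
Proof.
move=> yB; have B0 : 0 <= B by exact: le_trans (cabs_ge0 y) yB.
have [r0 r1] := andP r01.
have h : cabs (qpochn n y q) <= expR (B / (1 - r) * (1 - r ^+ n)).
  elim: n => [|n ih].
    by rewrite /qpochn big_ord0 cabs1 expr0 subrr mulr0 expR0.
  have -> : B / (1 - r) * (1 - r ^+ n.+1) = B / (1 - r) * (1 - r ^+ n) + B * r ^+ n.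
    by rewrite exprS; field; lra.
  rewrite qpochnS cabsM expRD; apply: ler_pM; rewrite ?cabs_ge0 //.
  apply: le_trans (expR_ge1Dx _); rewrite (le_trans (cabsB _ _)) // cabs1 lerD2l.
  by rewrite cabsM cabsX ler_wpM2r ?exprn_ge0.
apply: (le_trans h); rewrite ler_expR.
have rn : 0 <= r ^+ n by rewrite exprn_ge0.
have c0 : 0 <= B / (1 - r) by apply: divr_ge0; lra.
nra.
Qed.

(** The factor of index [n + k] changes the product by at most [E * B * r ^+ (n + k)]; the induction
    on [k] carries the exact geometric sum of these changes. *)
Lemma qpochn_cauchy (B : R) n k y : cabs y <= B ->
  cabs (qpochn (n + k) y q - qpochn n y q) <=
    expR (B / (1 - r)) * B / (1 - r) * r ^+ n.
Proof.
move=> yB; have B0 : 0 <= B by exact: le_trans (cabs_ge0 y) yB.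
have [r0 r1] := andP r01.
set E := expR _; have E0 : 0 <= E by exact: expR_ge0.
have h : cabs (qpochn (n + k) y q - qpochn n y q) <=
    E * B / (1 - r) * (r ^+ n - r ^+ (n + k)).
  elim: k => [|k ih]; first by rewrite addn0 !subrr cabs0 mulr0.
  rewrite addnS.
  have -> : E * B / (1 - r) * (r ^+ n - r ^+ (n + k).+1) =
     E * B / (1 - r) * (r ^+ n - r ^+ (n + k)) + E * (B * r ^+ (n + k)).
    by rewrite exprS; field; lra.
  have -> : qpochn (n + k).+1 y q - qpochn n y q =
     (qpochn (n + k) y q - qpochn n y q) - qpochn (n + k) y q * (y * q ^+ (n + k)).
    by rewrite qpochnS; ring.
  rewrite (le_trans (cabsB _ _)) // lerD // cabsM.
  apply: ler_pM; rewrite ?cabs_ge0 ?(qpochn_bound _ yB) //.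
  by rewrite cabsM cabsX ler_wpM2r ?exprn_ge0.
apply: (le_trans h).
have rn : 0 <= r ^+ (n + k) by rewrite exprn_ge0.
have c0 : 0 <= E * B / (1 - r) by apply: divr_ge0; [exact: mulr_ge0|lra].
nra.
Qed.

Lemma qpochn_cvg y : (fun n => qpochn n y q) @ \oo --> qpoch y q.
Proof. by apply: cvg_geometric r01 _ => n k; apply: qpochn_cauchy (lexx (cabs y)). Qed.

(** The Cauchy estimate depends on the argument only through [B], so the rate is uniform. The index
    [M], which varies with [x], serves only to reach the limit and drops out. *)
Lemma ucvg_qpoch (T : Type) (K : set T) (phi : T -> R[i]) : ubounded K phi ->
  ucvg K (fun n x => qpochn n (phi x) q) (fun x => qpoch (phi x) q).
Proof.
move=> [B hB] e e0.
have e2 : 0 < e / 2 by lra.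
have [N hN] := expr_small (expR (B / (1 - r)) * B / (1 - r)) r01 e2.
exists N => n Nn x Kx.
have /cvg_cabsP/(_ _ e2)[M hM] := @qpochn_cvg (phi x).
have h1 := qpochn_cauchy n M (hB x Kx).
have h2 := hM (n + M)%N (leq_addl _ _).
have h3 := hN n Nn.
have := cabs_triangle (qpochn n (phi x) q) (qpochn (n + M) (phi x) q) (qpoch (phi x) q).
by rewrite (cabs_distC (qpochn n _ _) (qpochn (n + M) _ _)); lra.
Qed.

Lemma ubounded_qpoch (T : Type) (K : set T) (phi : T -> R[i]) : ubounded K phi ->
  ubounded K (fun x => qpoch (phi x) q).
Proof.
move=> bphi; have [N hN] := ucvg_qpoch bphi ltr01.
have [B hB] := bphi; exists (expR (B / (1 - r)) + 1) => x Kx.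
have := hN N (leqnn N) x Kx; have := qpochn_bound N (hB x Kx).
have := cabs_sub_ge (qpoch (phi x) q) (qpochn N (phi x) q).
rewrite (cabs_distC (qpoch _ _)); lra.
Qed.

(** A product of factors [1 - z_j] with small [z_j >= 0] is at least one minus the sum of the [z_j];
    here that sum is at most 1/2. *)
Lemma qpochn_tail_bound (B : R) n y : cabs y <= B -> B / (1 - r) <= 1 / 2 ->
  1 / 2 <= cabs (qpochn n y q).
Proof.
move=> yB Br; have B0 : 0 <= B by exact: le_trans (cabs_ge0 y) yB.
have [r0 r1] := andP r01.
have c0 : 0 <= B / (1 - r) by apply: divr_ge0; lra.
suff h : 1 - B / (1 - r) * (1 - r ^+ n) <= cabs (qpochn n y q).
  have rn : 0 <= r ^+ n by rewrite exprn_ge0.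
  apply: le_trans h; nra.
elim: n => [|n ih]; first by rewrite /qpochn big_ord0 cabs1 expr0 subrr mulr0 subr0.
have -> : B / (1 - r) * (1 - r ^+ n.+1) = B / (1 - r) * (1 - r ^+ n) + B * r ^+ n.
  by rewrite exprS; field; lra.
rewrite qpochnS cabsM.
have rn : 0 <= r ^+ n by rewrite exprn_ge0.
have rn1 : r ^+ n <= 1 by rewrite exprn_ile1 // ltW.
have h1 : 1 - B * r ^+ n <= cabs (1 - y * q ^+ n).
  apply: le_trans (cabs_sub_ge _ _); rewrite cabs1 lerD2l lerN2 cabsM cabsX.
  exact: ler_wpM2r.
have S0 : 0 <= B / (1 - r) * (1 - r ^+ n) by apply: mulr_ge0 => //; lra.
have S1 : B / (1 - r) * (1 - r ^+ n) <= 1 / 2 by nra.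
have z0 : 0 <= B * r ^+ n by exact: mulr_ge0.
have B1 : B <= 1 / 2.
  by have : B / (1 - r) * (1 - r) = B by [field; lra]; nra.
have z1 : B * r ^+ n <= 1 / 2 by nra.
set S := B / (1 - r) * (1 - r ^+ n) in ih S0 S1 *.
set z := B * r ^+ n in h1 z0 z1 *.
apply: (@le_trans _ _ ((1 - S) * (1 - z))); first nra.
by apply: ler_pM => //; lra.
Qed.

(** The first [N] factors are bounded below one by one; [N] is chosen so that the tail falls under
    [qpochn_tail_bound]. Long partial products are then at least [m / 2], and passing to the limit
    costs another [m / 4]. *)
Lemma away0_qpoch (T : Type) (K : set T) (phi : T -> R[i]) : ubounded K phi ->
  (forall j, away0 K (fun x => 1 - phi x * q ^+ j)) ->
  away0 K (fun x => qpoch (phi x) q).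
Proof.
move=> bphi aphi; have [B hB] := bphi.
have [r0 r1] := andP r01.
have fin n : away0 K (fun x => qpochn n (phi x) q).
  elim: n => [|n [m m0 hm]].
    by exists 1 => // x _; rewrite /qpochn big_ord0 cabs1.
  have [m' m'0 hm'] := aphi n; exists (m * m') => [|x Kx]; first exact: mulr_gt0.
  by rewrite qpochnS cabsM; apply: ler_pM; rewrite ?hm ?hm' // ltW.
have [|N hN] := @expr_small R r (B / (1 - r)) (1 / 2) r01; first lra.
have [m m0 hm] := fin N.
have tail n x : K x -> m / 2 <= cabs (qpochn (N + n) (phi x) q).
  move=> Kx; rewrite qpochnD cabsM.
  have -> : m / 2 = m * (1 / 2) by lra.
  apply: ler_pM; [exact: ltW|lra|exact: hm|].
  apply: (@qpochn_tail_bound (B * r ^+ N)).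
    by rewrite cabsM cabsX ler_wpM2r ?exprn_ge0 ?hB.
  by rewrite mulrAC ltW ?hN.
exists (m / 4) => [|x Kx]; first lra.
have m4 : 0 < m / 4 by lra.
have [M hM] := ucvg_qpoch bphi m4.
have := hM (N + M)%N (leq_addl _ _) x Kx; have := tail M x Kx.
have := cabs_sub_ge (qpochn (N + M) (phi x) q) (qpoch (phi x) q).
have := cabs_sub_ge (qpochn (N + M) (phi x) q)
   (qpochn (N + M) (phi x) q - qpoch (phi x) q).
rewrite subKr; lra.
Qed.

Lemma qpoch_recl y : qpoch y q = (1 - y) * qpoch (y * q) q.
Proof.
apply: cabs_le_eq => e e0; have e2 : 0 < e / 2 by lra.
have y1 := cabs_ge0 (1 - y).
have ey : 0 < e / 2 / (cabs (1 - y) + 1) by apply: divr_gt0 => //; lra.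
have /cvg_cabsP/(_ _ e2)[N hN] := @qpochn_cvg y.
have /cvg_cabsP/(_ _ ey)[M hM] := @qpochn_cvg (y * q).
have h1 := hN (N + M).+1 (leqW (leq_addr _ _)).
have h2 := hM (N + M)%N (leq_addl _ _).
apply: le_trans (cabs_triangle _ (qpochn (N + M).+1 y q) _) _.
have -> : e = e / 2 + e / 2 by lra.
rewrite cabs_distC lerD ?ltW // qpochnSl -mulrBr cabsM.
rewrite ltr_pdivlMr in h2; last lra.
have := cabs_ge0 (qpochn (N + M) (y * q) q - qpoch (y * q) q); nra.
Qed.

Lemma qpoch_split n y : qpoch y q = qpochn n y q * qpoch (y * q ^+ n) q.
Proof.
elim: n => [|n ih]; first by rewrite /qpochn big_ord0 mul1r expr0 mulr1.
by rewrite ih (qpoch_recl (y * q ^+ n)) qpochnS exprSr !mulrA.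
Qed.

Lemma qpoch0 : qpoch 0 q = 1.
Proof.
apply: cabs_le_eq => e e0; have /cvg_cabsP/(_ _ e0)[N hN] := @qpochn_cvg 0.
have h1 : qpochn N 0 q = 1 by rewrite /qpochn big1 // => i _; rewrite mul0r subr0.
by have := hN N (leqnn N); rewrite cabs_distC h1 => /ltW.
Qed.

Lemma qpoch_neq0 y : (forall j, y * q ^+ j != 1) -> qpoch y q != 0.
Proof.
(* A single value is treated as a constant function on a one-point type, for which [away0] amounts
   to non-vanishing. *)
move=> hy; apply: (@away0_neq0 _ _ setT (fun _ : unit => qpoch y q) tt) => //.
apply: (@away0_qpoch _ _ (fun=> y)); first by exists (cabs y).
move=> j; exists (cabs (1 - y * q ^+ j)) => //.
by rewrite cabs_gt0 subr_eq0 eq_sym hy.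
Qed.

End QProducts.

(** * Rational functions and the dilation by q *)

Section QDifference.
Variables (R : realType) (g : R -> R[i]) (q : R[i]).
Hypotheses (cont_g : {within `[0, 1], continuous g}) (closed_g : g 0 = g 1)
  (rect_g : rectifiable g) (q0 : q != 0).

(* f(x) dx and its image under x |-> q x have the same integral along g. *)
Definition qinvariant (f : R[i] -> R[i]) : Prop :=
  is_curve_integral g (fun x => f x - q * f (q * x)) 0.

(* The curves g and q g have the same winding number about p. *)
Definition qpole (p : R[i]) : Prop :=
  [/\ ~ curve g p, ~ curve g (p / q)
    & is_curve_integral g (fun x => (x - p)^-1 - (x - p / q)^-1) 0].

Lemma qinvariant_eq f1 f2 : (forall x, curve g x -> f1 x = f2 x) ->
  (forall x, curve g x -> f1 (q * x) = f2 (q * x)) ->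
  qinvariant f1 -> qinvariant f2.
Proof. by move=> h1 h2; apply: is_curve_integral_eq => x cx; rewrite h1 ?h2. Qed.

Lemma qinvariantD f1 f2 : qinvariant f1 -> qinvariant f2 ->
  qinvariant (fun x => f1 x + f2 x).
Proof.
move=> h1 h2; have := is_curve_integralD h1 h2; rewrite addr0.
by apply: is_curve_integral_eq => x _; ring.
Qed.

Lemma qinvariantZ c f : qinvariant f -> qinvariant (fun x => c * f x).
Proof.
move=> h; have := is_curve_integralZ c h; rewrite mulr0.
by apply: is_curve_integral_eq => x _; ring.
Qed.

Lemma qinvariant_sum (J : Type) (r : seq J) (F : J -> R[i] -> R[i]) :
  (forall j, qinvariant (F j)) -> qinvariant (fun x => \sum_(j <- r) F j x).
Proof.
move=> h; elim: r => [|j r ih].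
  apply: is_curve_integral_eq (is_curve_integral0 g) => x _.
  by rewrite !big_nil mulr0 subr0.
by apply: qinvariant_eq (qinvariantD (h j) ih) => x _; rewrite big_cons.
Qed.

Lemma qinvariant_exp n : qinvariant (fun x => x ^+ n).
Proof.
have := is_curve_integralZ (1 - q ^+ n.+1) (is_curve_integral_pos_power cont_g closed_g rect_g 0 n).
rewrite mulr0; apply: is_curve_integral_eq => x _.
by rewrite subr0 exprMn exprS; ring.
Qed.

(** For a simple pole the claim is the third clause of [qpole]. For higher order both terms, with
    poles at [p] and [p / q], have primitives. *)
Lemma qinvariant_inv_exp p n : qpole p -> qinvariant (fun x => (x - p)^-1 ^+ n.+1).
Proof.
move=> [np npq hp].
have qx x : (q * x - p)^-1 = q^-1 * (x - p / q)^-1.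
  by rewrite -invfM; congr (_^-1); field.
case: n => [|n].
  by apply: is_curve_integral_eq hp => x _; rewrite !expr1 qx mulVKf.
have := is_curve_integralD
  (is_curve_integral_neg_power cont_g closed_g rect_g n np)
  (is_curve_integralZ (- (q * q^-1 ^+ n.+2))
     (is_curve_integral_neg_power cont_g closed_g rect_g n npq)).
rewrite mulr0 addr0; apply: is_curve_integral_eq => x _.
by rewrite qx [in RHS]exprMn; ring.
Qed.

Lemma qpole_neq p x : qpole p -> curve g x -> (x - p != 0) && (q * x - p != 0).
Proof.
move=> [np npq _] cx; rewrite !subr_eq0; apply/andP; split; apply/eqP => h.
  by apply: np; rewrite -h.
by apply: npq; rewrite -h mulrAC divff // mul1r.
Qed.

(** Partial fractions by induction on the number of factors: if all poles coincide the product is a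
    pure power; otherwise two distinct poles [p], [p'] are separated through [1/(x - p) - 1/(x - p')
    = (p - p') / ((x - p)(x - p'))]. *)
Lemma qinvariant_inv_prod ps : (forall p, p \in ps -> qpole p) ->
  qinvariant (fun x => \prod_(p <- ps) (x - p)^-1).
Proof.
have [n] := ubnP (size ps); elim: n ps => [//|n ih] [|p s] hs hps.
  apply: qinvariant_eq (qinvariant_exp 0) => x _; by rewrite big_nil expr0.
have [/all_pred1P es|] := boolP (all (pred1 p) s).
  have pp : qpole p by apply: hps; rewrite mem_head.
  apply: qinvariant_eq (qinvariant_inv_exp (size s) pp) => x _;
    rewrite big_cons es big_nseq -/(iter _ _ _) size_nseq exprS; congr (_ * _);
    by rewrite -Monoid.iteropE; case: (size s).
rewrite -has_predC => /hasP[p' p's /= p'p].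
have ps' := perm_to_rem p's.
have sz : size s = (size (rem p' s)).+1 by rewrite (perm_size ps').
have qp : qpole p by apply: hps; rewrite mem_head.
have qp' : qpole p' by apply: hps; rewrite inE p's orbT.
have hr t : t \in rem p' s -> qpole t.
  by move=> ht; apply: hps; rewrite inE (mem_rem ht) orbT.
have h1 : qinvariant (fun x => \prod_(t <- p :: rem p' s) (x - t)^-1).
  by apply: ih => [|t]; [move: hs => /=; rewrite sz | rewrite inE => /predU1P[->|/hr]].
have h2 : qinvariant (fun x => \prod_(t <- p' :: rem p' s) (x - t)^-1).
  by apply: ih => [|t]; [move: hs => /=; rewrite sz | rewrite inE => /predU1P[->|/hr]].
have pp' : p - p' != 0 by rewrite subr_eq0 eq_sym.
apply: qinvariant_eq (qinvariantZ (p - p')^-1 (qinvariantD h1 (qinvariantZ (-1) h2))) => x cx;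
  have /andP[x1 x2] := qpole_neq qp cx; have /andP[x3 x4] := qpole_neq qp' cx;
  rewrite [in RHS]big_cons [in RHS](perm_big _ ps') /= !big_cons;
  by field; rewrite ?x1 ?x2 ?x3 ?x4 pp'.
Qed.

(** Writing [P] as [Q * ('X - p)] plus the constant [P.[p]] cancels one pole in the first term and
    leaves a constant numerator in the second. *)
Lemma qinvariant_rational (P : {poly R[i]}) ps : (forall p, p \in ps -> qpole p) ->
  qinvariant (fun x => P.[x] * \prod_(p <- ps) (x - p)^-1).
Proof.
elim: ps P => [|p s ih] P hps.
  apply: qinvariant_eq (@qinvariant_sum _ (index_enum 'I_(size P))
    (fun i x => P`_i * x ^+ i) _) => [x _|x _|i];
    rewrite ?big_nil ?mulr1 ?horner_coef //.
  exact: qinvariantZ (qinvariant_exp i).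
have qp : qpole p by apply: hps; rewrite mem_head.
have hs t : t \in s -> qpole t by move=> ts; apply: hps; rewrite inE ts orbT.
have /factor_theorem[Q hQ] : root (P - P.[p]%:P) p.
  by rewrite rootE hornerD hornerN hornerC subrr.
have PE x : P.[x] = Q.[x] * (x - p) + P.[p].
  have := congr1 (horner^~ x) hQ; rewrite !hornerE => <-; by rewrite subrK.
apply: qinvariant_eq (qinvariantD (ih Q hs) (qinvariantZ P.[p] (qinvariant_inv_prod hps)))
  => x cx; have /andP[x1 x2] := qpole_neq qp cx; rewrite big_cons [in RHS]PE;
  by field; rewrite ?x1 ?x2.
Qed.

(** Convergence is required on the curve and on its dilate by [q], since the integrand samples [f]
    on both. *)
Lemma qinvariant_uniform F f : (forall n, qinvariant (F n)) ->
  ucvg (curve g) F f ->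
  ucvg (curve g) (fun n x => F n (q * x)) (fun x => f (q * x)) -> qinvariant f.
Proof.
move=> hF c1 c2; apply: is_curve_integral_uniform => // e e0.
have c3 : ucvg (curve g) (fun n x => F n x - q * F n (q * x)) (fun x => f x - q * f (q * x)).
  apply: ucvgB => // e' e'0.
  have qq := cabs_ge0 q.
  have [|N hN] := c2 (e' / (cabs q + 1)); first by apply: divr_gt0 => //; lra.
  exists N => n /hN h x /h; rewrite -mulrBr cabsM ler_pdivlMr; last lra.
  have := cabs_ge0 (F n (q * x) - f (q * x)); nra.
have [N hN] := c3 e e0.
exists (fun x => F N x - q * F N (q * x)), 0; split; first exact: hF.
  by rewrite subrr cabs0 ltW.
exact: hN.
Qed.

End QDifference.

(** * Rational functions with poles in a prescribed set *)

Section RationalFunctions.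
Variables (R : realType) (S : set R[i]).
Implicit Types f : R[i] -> R[i].

(* Values at 0 are left free: there x^-1 = 0 breaks the identities needed. *)
Definition rational_poles f : Prop :=
  exists (P : {poly R[i]}) (ps : seq R[i]), (forall p, p \in ps -> S p) /\
    forall x, x != 0 -> f x = P.[x] * \prod_(p <- ps) (x - p)^-1.

Lemma rational_poles_eq f1 f2 : (forall x, x != 0 -> f1 x = f2 x) ->
  rational_poles f1 -> rational_poles f2.
Proof. by move=> h [P [ps [hps hf]]]; exists P, ps; split=> // x x0; rewrite -h ?hf. Qed.

Lemma rational_poles_horner (P : {poly R[i]}) : rational_poles (horner P).
Proof. by exists P, [::]; split => // x _; rewrite big_nil mulr1. Qed.

Lemma rational_poles_cst c : rational_poles (fun=> c).
Proof.
by apply: rational_poles_eq (rational_poles_horner c%:P) => x _; rewrite hornerC.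
Qed.

Lemma rational_poles_inv p : S p -> rational_poles (fun x => (x - p)^-1).
Proof.
move=> Sp; exists 1, [:: p]; split => [t|x _]; first by rewrite inE => /eqP->.
by rewrite big_seq1 hornerC mul1r.
Qed.

Lemma rational_polesM f1 f2 : rational_poles f1 -> rational_poles f2 ->
  rational_poles (fun x => f1 x * f2 x).
Proof.
move=> [P1 [ps1 [h1 e1]]] [P2 [ps2 [h2 e2]]]; exists (P1 * P2), (ps1 ++ ps2).
split=> [p|x x0]; first by rewrite mem_cat => /orP[/h1|/h2].
by rewrite e1 // e2 // big_cat hornerM /= mulrACA.
Qed.

Lemma rational_poles_prod (I : Type) (r : seq I) (F : I -> R[i] -> R[i]) :
  (forall i, rational_poles (F i)) -> rational_poles (fun x => \prod_(i <- r) F i x).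
Proof.
move=> hF; elim: r => [|i r ih].
  by apply: rational_poles_eq (rational_poles_cst 1) => x _; rewrite big_nil.
by apply: rational_poles_eq (rational_polesM (hF i) ih) => x _; rewrite big_cons.
Qed.

End RationalFunctions.

(** * The Askey-Wilson weight *)

Section AskeyWilson.
Variables (R : realType) (g : R -> R[i]) (q : R[i]).
Hypotheses (cont_g : {within `[0, 1], continuous g}) (closed_g : g 0 = g 1)
  (rect_g : rectifiable g) (ccw_g : counterclockwise g) (int0 : curve_interior g 0)
  (q0 : q != 0) (q1 : cabs q < 1).
Implicit Types (e x : R[i]) (es : seq R[i]).

Definition aw_param e : Prop := (forall k : nat, curve_interior g (e * q ^+ k)) /\
  (e != 0 -> forall k : nat, curve_exterior g (e^-1 * q ^- k)).

Lemma aw_param0 : aw_param 0.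
Proof. by split => [k|]; rewrite ?mul0r ?eqxx. Qed.

Lemma aw_paramM e n : aw_param e -> aw_param (e * q ^+ n).
Proof.
move=> [h1 h2]; split => [k|].
  by rewrite -mulrA -exprD.
rewrite mulf_eq0 negb_or => /andP[e0 _] k.
by rewrite invfM -mulrA -invfM -exprD; exact: h2.
Qed.

Lemma qpole_interior p : curve_interior g p -> curve_interior g (p / q) -> qpole g q p.
Proof.
move=> h1 h2; split; [exact: h1.1|exact: h2.1|].
have := is_curve_integralD (ccw_g h1) (is_curve_integralZ (-1) (ccw_g h2)).
by rewrite mulN1r subrr; apply: is_curve_integral_eq => x _; rewrite mulN1r.
Qed.

Lemma qpole_exterior p : curve_exterior g p -> curve_exterior g (p / q) -> qpole g q p.
Proof.
move=> h1 h2; split; [exact: h1.1|exact: h2.1|].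
have := is_curve_integralD (is_curve_integral_exterior cont_g closed_g rect_g h1)
  (is_curve_integralZ (-1) (is_curve_integral_exterior cont_g closed_g rect_g h2)).
by rewrite mulr0 addr0; apply: is_curve_integral_eq => x _; rewrite mulN1r.
Qed.

Lemma qpole0 : qpole g q 0.
Proof. by apply: qpole_interior; rewrite ?mul0r. Qed.

Lemma curve_neq0 x : curve g x -> x != 0.
Proof. by move=> cx; apply/eqP => x0; apply: int0.1; rewrite -x0. Qed.

Lemma ubounded_id : ubounded (curve g) id.
Proof. by have [B _ hB] := curve_bounded cont_g; exists B. Qed.

Lemma away0_sub p : ~ curve g p -> away0 (curve g) (fun x => x - p).
Proof. by move=> /(curve_dist cont_g). Qed.

Lemma away0_inv : away0 (curve g) (fun x => x^-1).
Proof.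
have [B B1 hB] := curve_bounded cont_g; exists B^-1; first by rewrite invr_gt0; lra.
move=> x cx; have B0 : 0 < B by lra.
have x0 : 0 < cabs x by rewrite cabs_gt0 curve_neq0.
by rewrite cabsV lef_pV2 ?posrE ?hB.
Qed.

Lemma ubounded_inv : ubounded (curve g) (fun x => x^-1).
Proof.
apply: away0_ubounded; have [d d0 hd] := away0_sub int0.1.
by exists d => // x /hd; rewrite subr0.
Qed.

Lemma away0_eq (f1 f2 : R[i] -> R[i]) : (forall x, curve g x -> f1 x = f2 x) ->
  away0 (curve g) f1 -> away0 (curve g) f2.
Proof. by move=> h [m m0 hm]; exists m => // x cx; rewrite -h ?hm. Qed.

Lemma away0_cst (c : R[i]) : c != 0 -> away0 (curve g) (fun=> c).
Proof. by move=> c0; exists (cabs c) => //; rewrite cabs_gt0. Qed.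

Lemma away0_mul_param e j : aw_param e ->
  away0 (curve g) (fun x => 1 - e * x * q ^+ j).
Proof.
move=> [_ he]; have [->|e0] := eqVneq e 0.
  apply: away0_eq (away0_cst (oner_neq0 _)) => x _; by rewrite !mul0r subr0.
have qj : q ^+ j != 0 by rewrite expf_neq0.
have eq0 : - (e * q ^+ j) != 0 by rewrite oppr_eq0 mulf_neq0.
apply: away0_eq (away0M (away0_cst eq0) (away0_sub (he e0 j).1)) => x _.
by field; rewrite ?e0 ?q0 ?qj.
Qed.

Lemma away0_div_param e j : aw_param e ->
  away0 (curve g) (fun x => 1 - e / x * q ^+ j).
Proof.
move=> [he _].
apply: away0_eq (away0M (away0_sub (he j).1) away0_inv) => x cx.
by field; rewrite curve_neq0.
Qed.

(** The function h of the overview. With the extra [q] on one factor of each pair, h(x) and h(q x)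
    are both rational multiples of the weight. *)
Definition aw_kernel es x : R[i] := qpoch (x ^+ 2) q * qpoch (q * x ^- 2) q *
  \prod_(e <- es) ((qpoch (e * x) q)^-1 * (qpoch (q * (e / x)) q)^-1).

Definition aw_kerneln es (n : nat) x : R[i] := qpochn n (x ^+ 2) q * qpochn n (q * x ^- 2) q *
  \prod_(e <- es) ((qpochn n (e * x) q)^-1 * (qpochn n (q * (e / x)) q)^-1).

(** The poles are 0, the exterior points [e^-1 * q ^- j] and the interior points [e * q ^+ j.+1].
    Division by [q] sends them to 0, [e^-1 * q ^- j.+1] and [e * q ^+ j], so no pole changes
    sides. *)
Lemma rational_poles_aw_kerneln es n : (forall e, e \in es -> aw_param e) ->
  rational_poles (qpole g q) (aw_kerneln es n).
Proof.
move=> hes.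
have inv0 : rational_poles (qpole g q) (fun x => x^-1).
  by apply: rational_poles_eq (rational_poles_inv qpole0) => x _; rewrite subr0.
apply: rational_polesM; first apply: rational_polesM.
- apply: (@rational_poles_prod _ _ _ _ (fun j : 'I_n => fun x => 1 - x ^+ 2 * q ^+ j)) => j.
  apply: rational_poles_eq (rational_poles_horner _ (1%:P - q ^+ j *: 'X^2)) => x _.
  by rewrite hornerD hornerN hornerZ hornerC hornerXn mulrC.
- apply: (@rational_poles_prod _ _ _ _ (fun j : 'I_n => fun x => 1 - q * x ^- 2 * q ^+ j)) => j.
  apply: rational_poles_eq (rational_polesM (rational_poles_horner _ ('X^2 - (q ^+ j.+1)%:P))
    (rational_polesM inv0 inv0)) => x x0.
  by rewrite hornerD hornerN hornerC hornerXn (exprS q); field.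
elim: es hes => [|e es ih] hes.
  by apply: rational_poles_eq (rational_poles_cst _ 1) => x _; rewrite big_nil.
have [hi he] : aw_param e by apply: hes; rewrite mem_head.
have {}ih := ih (fun t ht => hes t (@mem_behead _ (e :: es) t ht)).
pose F1 (j : 'I_n) x := (1 - e * x * q ^+ j)^-1.
pose F2 (j : 'I_n) x := (1 - q * (e / x) * q ^+ j)^-1.
suff [h1 h2] : (forall j, rational_poles (qpole g q) (F1 j)) /\
    (forall j, rational_poles (qpole g q) (F2 j)).
  apply: rational_poles_eq (rational_polesM (rational_polesM
     (rational_poles_prod (index_enum 'I_n) h1) (rational_poles_prod (index_enum 'I_n) h2)) ih)
     => x _.
  by rewrite big_cons -!prodfV.
split=> j.
  have [e0|e0] := eqVneq e 0.
    apply: rational_poles_eq (rational_poles_cst _ 1) => x _.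
    by rewrite /F1 e0 !mul0r subr0 invr1.
  have qj : q ^+ j != 0 by rewrite expf_neq0.
  have hp : qpole g q (e^-1 * q ^- j).
    apply: qpole_exterior; first exact: he.
    by rewrite -mulrA -invfM -exprSr; exact: he.
  apply: rational_poles_eq (rational_polesM (rational_poles_cst _ (- (e * q ^+ j))^-1)
     (rational_poles_inv hp)) => x _.
  by rewrite /F1 -invfM; congr (_^-1); field; rewrite ?e0 ?q0 ?qj.
have hp : qpole g q (e * q ^+ j.+1).
  apply: qpole_interior; first exact: hi.
  by rewrite exprSr mulrA mulfK.
apply: rational_poles_eq (rational_polesM (rational_poles_horner _ 'X)
   (rational_poles_inv hp)) => x x0.
rewrite /F2 hornerX -[X in X * _]invrK -invfM; congr (_^-1).
by rewrite exprS; field.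
Qed.

(** Stated along a map [phi] so as to cover both the curve, with [phi] the identity, and its dilate
    by [q]. *)
Lemma ucvg_aw_kernel es (phi : R[i] -> R[i]) :
  ubounded (curve g) phi -> ubounded (curve g) (fun x => (phi x)^-1) ->
  (forall e, e \in es -> forall j, away0 (curve g) (fun x => 1 - e * phi x * q ^+ j)) ->
  (forall e, e \in es -> forall j, away0 (curve g) (fun x => 1 - q * (e / phi x) * q ^+ j)) ->
  ucvg (curve g) (fun n x => aw_kerneln es n (phi x)) (fun x => aw_kernel es (phi x)).
Proof.
move=> bphi bphiV h1 h2.
have b2 : ubounded (curve g) (fun x => phi x ^+ 2).
  by have := uboundedM bphi bphi.
have b3 : ubounded (curve g) (fun x => q * phi x ^- 2).
  have [M hM] := uboundedM (ubounded_cst (curve g) q) (uboundedM bphiV bphiV).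
  by exists M => x cx; rewrite -exprVn expr2; exact: hM.
suff [u c] : ubounded (curve g) (fun x => \prod_(e <- es)
      ((qpoch (e * phi x) q)^-1 * (qpoch (q * (e / phi x)) q)^-1)) /\
    ucvg (curve g) (fun n x => \prod_(e <- es)
      ((qpochn n (e * phi x) q)^-1 * (qpochn n (q * (e / phi x)) q)^-1))
      (fun x => \prod_(e <- es)
      ((qpoch (e * phi x) q)^-1 * (qpoch (q * (e / phi x)) q)^-1)).
  apply: ucvgM => //; first by apply: uboundedM; exact: ubounded_qpoch.
  by apply: ucvgM; [exact: ubounded_qpoch|exact: ubounded_qpoch|exact: ucvg_qpoch|exact: ucvg_qpoch].
elim: es h1 h2 => [|e es ih] h1 h2.
  split; first by exists 1 => x _; rewrite big_nil cabs1.
  by apply: ucvg_eq (ucvg_cst (curve g) (fun=> 1)) => *; rewrite big_nil.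
have [u c] := ih (fun t ht => h1 t (@mem_behead _ (e :: es) t ht)) (fun t ht => h2 t (@mem_behead _ (e :: es) t ht)).
have bu : ubounded (curve g) (fun x => e * phi x) by apply: uboundedM; first exact: ubounded_cst.
have bv : ubounded (curve g) (fun x => q * (e / phi x)).
  by apply: uboundedM; [exact: ubounded_cst|apply: uboundedM; first exact: ubounded_cst].
have a1 := away0_qpoch q1 bu (h1 e (mem_head _ _)).
have a2 := away0_qpoch q1 bv (h2 e (mem_head _ _)).
have u1 := away0_ubounded a1. have u2 := away0_ubounded a2.
have c1 := ucvgV a1 (ucvg_qpoch q1 bu). have c2 := ucvgV a2 (ucvg_qpoch q1 bv).
split.
  have [M hM] := uboundedM (uboundedM u1 u2) u.
  by exists M => x cx; rewrite big_cons; exact: hM.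
by apply: ucvg_eq (ucvgM (uboundedM u1 u2) u (ucvgM u1 u2 c1 c2) c) => *; rewrite big_cons.
Qed.

Lemma qinvariant_aw_kernel es : (forall e, e \in es -> aw_param e) ->
  qinvariant g q (aw_kernel es).
Proof.
move=> hes; apply: (qinvariant_uniform rect_g) (aw_kerneln es) _ _ _ _.
- move=> n; have [P [ps [hps hP]]] := rational_poles_aw_kerneln n hes.
  apply: qinvariant_eq (qinvariant_rational cont_g closed_g rect_g q0 P hps) => x cx.
    by rewrite hP ?curve_neq0.
  by rewrite hP // mulf_neq0 // curve_neq0.
- apply: ucvg_aw_kernel => [|| |e ees j]; [exact: ubounded_id|exact: ubounded_inv| |].
    by move=> e ees j; apply: away0_mul_param; exact: hes.
  apply: away0_eq (away0_div_param j.+1 (hes e ees)) => x _.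
  by rewrite exprS; ring.
- apply: (@ucvg_aw_kernel es (fun x => q * x)) => [|||e ees j].
  + by apply: uboundedM; [exact: ubounded_cst|exact: ubounded_id].
  + have [M hM] := uboundedM (ubounded_cst (curve g) q^-1) ubounded_inv.
    by exists M => x cx; rewrite invfM; exact: hM.
  + move=> e ees j; apply: away0_eq (away0_mul_param j.+1 (hes e ees)) => x _.
    by rewrite exprS; ring.
  (* On the dilated curve the factor [q] cancels, so the index stays [j] and starts at the parameter
     [e] itself. *)
  + apply: away0_eq (away0_div_param j (hes e ees)) => x cx.
    by rewrite invfM; field; rewrite curve_neq0 ?q0.
Qed.

Definition aw_weight es x : R[i] := qpoch (x ^+ 2) q * qpoch (x ^- 2) q /
  \prod_(e <- es) (qpoch (e * x) q * qpoch (e / x) q) / x.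

Lemma aw_param_qpoch_neq0 e x : aw_param e -> curve g x ->
  (1 - e * x != 0) && (1 - e / x != 0) &&
  (qpoch (e * x * q) q != 0) && (qpoch (e / x * q) q != 0).
Proof.
move=> he cx.
have b1 : ubounded (curve g) (fun x => e * x).
  by apply: uboundedM; [exact: ubounded_cst|exact: ubounded_id].
have b2 : ubounded (curve g) (fun x => e / x).
  by apply: uboundedM; [exact: ubounded_cst|exact: ubounded_inv].
have := away0_neq0 (away0_qpoch q1 b1 (fun j => away0_mul_param j he)) cx.
have := away0_neq0 (away0_qpoch q1 b2 (fun j => away0_div_param j he)) cx.
rewrite (qpoch_recl q1 (e * x)) (qpoch_recl q1 (e / x)).
by rewrite !mulf_eq0 !negb_or => /andP[-> ->] /andP[-> ->].
Qed.

(** The integrand is [a * (h(x) - q * h(q * x))]. Once the infinite products are reduced to common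
    ones by [qpoch_recl], this is an identity of rational functions. *)
Lemma is_curve_integral_aw_step a b c d : (forall e, e \in [:: a; b; c; d] -> aw_param e) ->
  is_curve_integral g (fun x => ((1 - a * b) * (1 - a * c) * (1 - a * d) -
    (1 - a * b * c * d) * ((1 - a * x) * (1 - a / x))) * aw_weight [:: a; b; c; d] x) 0.
Proof.
move=> hes; have := is_curve_integralZ a (qinvariant_aw_kernel hes); rewrite mulr0.
apply: is_curve_integral_eq => x cx.
have x0 := curve_neq0 cx.
have ne e : e \in [:: a; b; c; d] -> (1 - e * x != 0) && (1 - e / x != 0) &&
  (qpoch (e * x * q) q != 0) && (qpoch (e / x * q) q != 0).
  by move=> /hes he; exact: aw_param_qpoch_neq0.
move: (ne a) (ne b) (ne c) (ne d); rewrite !inE !eqxx !orbT /=.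
move=> /(_ isT)/andP[/andP[/andP[a1 a2] a3] a4] /(_ isT)/andP[/andP[/andP[b1 b2] b3] b4].
move=> /(_ isT)/andP[/andP[/andP[c1 c2] c3] c4] /(_ isT)/andP[/andP[/andP[d1 d2] d3] d4].
rewrite /aw_kernel /aw_weight !big_cons !big_nil !mulr1.
have qe e : q * (e / x) = e / x * q by ring.
have qe' e : q * (e / (q * x)) = e / x by field; rewrite x0.
have ee e : e * (q * x) = e * x * q by ring.
rewrite !qe !qe' !ee.
have r1 e : qpoch (e * x) q = (1 - e * x) * qpoch (e * x * q) q by exact: qpoch_recl.
have r2 e : qpoch (e / x) q = (1 - e / x) * qpoch (e / x * q) q by exact: qpoch_recl.
rewrite (r1 a) (r1 b) (r1 c) (r1 d) (r2 a) (r2 b) (r2 c) (r2 d).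
(* The numerators are brought to the common products at [(q * x) ^+ 2] and [q * x ^- 2], which are
   then treated as indeterminates. *)
have s1 : qpoch (x ^+ 2) q = (1 - x ^+ 2) * ((1 - x ^+ 2 * q) * qpoch ((q * x) ^+ 2) q).
  rewrite (qpoch_recl q1 (x ^+ 2)) (qpoch_recl q1 (x ^+ 2 * q)).
  by have -> : (q * x) ^+ 2 = x ^+ 2 * q * q by ring.
have s2 : qpoch (x ^- 2) q = (1 - x ^- 2) * qpoch (q * x ^- 2) q.
  by rewrite [q * _]mulrC; exact: qpoch_recl.
have s3 : qpoch (q * (q * x) ^- 2) q =
    (1 - (q * x ^+ 2)^-1) * ((1 - x ^- 2) * qpoch (q * x ^- 2) q).
  have -> : q * (q * x) ^- 2 = (q * x ^+ 2)^-1 by field; rewrite x0.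
  rewrite -s2 (qpoch_recl q1 (q * x ^+ 2)^-1).
  by have -> : (q * x ^+ 2)^-1 * q = x ^- 2 by field; rewrite x0.
rewrite s1 s2 s3.
move: (qpoch ((q * x) ^+ 2) q) (qpoch (q * x ^- 2) q) => U V.
move: (qpoch (a * x * q) q) (qpoch (a / x * q) q) a3 a4 => A3 A4 a3 a4.
move: (qpoch (b * x * q) q) (qpoch (b / x * q) q) b3 b4 => B3 B4 b3 b4.
move: (qpoch (c * x * q) q) (qpoch (c / x * q) q) c3 c4 => C3 C4 c3 c4.
move: (qpoch (d * x * q) q) (qpoch (d / x * q) q) d3 d4 => D3 D4 d3 d4.
(* [field] clears the inner division by [x], so the non-vanishing of [1 - e / x] is needed in the
   form [x - e != 0]. *)
have aux e : 1 - e / x != 0 -> x - e != 0.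
  by apply: contra => /eqP h; rewrite -[1](divff x0) -mulrBl h mul0r.
move: a2 b2 c2 d2 => /aux a2 /aux b2 /aux c2 /aux d2.
by field; rewrite x0 d4 d2 d3 d1 c4 c2 c3 c1 b4 b2 b3 b1 a4 a2 a3 a1 q0.
Qed.

Lemma aw_weight_shift a es n x : aw_param a -> curve g x ->
  aw_weight (a * q ^+ n :: es) x =
  qpochn n (a * x) q * qpochn n (a / x) q * aw_weight (a :: es) x.
Proof.
move=> ha cx; have x0 := curve_neq0 cx.
have /andP[/andP[/andP[a1 a2] a3] a4] := aw_param_qpoch_neq0 ha cx.
rewrite /aw_weight !big_cons.
have := mulf_neq0 a1 a3; rewrite -(qpoch_recl q1) (qpoch_split q1 n).
have := mulf_neq0 a2 a4; rewrite -(qpoch_recl q1) (qpoch_split q1 n).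
have -> : a * q ^+ n * x = a * x * q ^+ n by ring.
have -> : a * q ^+ n / x = a / x * q ^+ n by ring.
rewrite !mulf_eq0 !negb_or => /andP[p1 p2] /andP[p3 p4].
rewrite [((qpoch (_ * q ^+ n) _ * _) * _)^-1]invfM [((_ * qpoch _ _ * _) * _)^-1]invfM.
move: (\prod_(e <- es) _)^-1 => Z.
by field; rewrite x0 p1 p2 p3 p4.
Qed.

(** The relation for [n] is multiplied by the next factors of the three products, and the one-step
    relation for [a * q ^+ n] by [(abcd; q)_n]. In the sum the mixed terms cancel, because the
    weight at [a * q ^+ n] is the original one times [(a x, a / x; q)_n]. *)
Lemma is_curve_integral_aw_iter a b c d n :
  (forall e, e \in [:: a; b; c; d] -> aw_param e) ->
  is_curve_integral g (fun x => (qpochn n (a * b) q * qpochn n (a * c) q * qpochn n (a * d) q -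
    qpochn n (a * b * c * d) q * (qpochn n (a * x) q * qpochn n (a / x) q)) *
    aw_weight [:: a; b; c; d] x) 0.
Proof.
move=> hes; have ha : aw_param a by apply: hes; rewrite mem_head.
elim: n => [|n ih].
  apply: is_curve_integral_eq (is_curve_integral0 g) => x _.
  by rewrite /qpochn !big_ord0 !mulr1 subrr mul0r.
have step : forall e, e \in [:: a * q ^+ n; b; c; d] -> aw_param e.
  move=> e; rewrite inE => /predU1P[->|he]; first exact: aw_paramM.
  by apply: hes; rewrite inE he orbT.
have := is_curve_integralD
  (is_curve_integralZ ((1 - a * b * q ^+ n) * (1 - a * c * q ^+ n) * (1 - a * d * q ^+ n)) ih)
  (is_curve_integralZ (qpochn n (a * b * c * d) q) (is_curve_integral_aw_step step)).
rewrite !mulr0 addr0; apply: is_curve_integral_eq => x cx.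
by rewrite (aw_weight_shift _ n ha cx) !qpochnS; ring.
Qed.

Lemma ubounded_aw_weight es : (forall e, e \in es -> aw_param e) ->
  ubounded (curve g) (aw_weight es).
Proof.
move=> hes.
have b2 : ubounded (curve g) (fun x => x ^+ 2) by have := uboundedM ubounded_id ubounded_id.
have b3 : ubounded (curve g) (fun x => x ^- 2).
  by have [M hM] := uboundedM ubounded_inv ubounded_inv;
    exists M => x cx; rewrite -exprVn expr2; exact: hM.
apply: uboundedM ubounded_inv; apply: uboundedM.
  by apply: uboundedM; exact: ubounded_qpoch.
apply: away0_ubounded; elim: es hes => [|e es ih] hes.
  by apply: away0_eq (away0_cst (oner_neq0 _)) => x _; rewrite big_nil.
have he : aw_param e by apply: hes; rewrite mem_head.
have {}ih := ih (fun t ht => hes t (@mem_behead _ (e :: es) t ht)).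
have b1 : ubounded (curve g) (fun x => e * x).
  by apply: uboundedM; [exact: ubounded_cst|exact: ubounded_id].
have b4 : ubounded (curve g) (fun x => e / x).
  by apply: uboundedM; [exact: ubounded_cst|exact: ubounded_inv].
apply: away0_eq (away0M (away0M
  (away0_qpoch q1 b1 (fun j => away0_mul_param j he))
  (away0_qpoch q1 b4 (fun j => away0_div_param j he))) ih) => x _.
by rewrite big_cons.
Qed.

Lemma is_curve_integral_aw_limit a b c d :
  (forall e, e \in [:: a; b; c; d] -> aw_param e) ->
  is_curve_integral g (fun x => (qpoch (a * b) q * qpoch (a * c) q * qpoch (a * d) q -
    qpoch (a * b * c * d) q * (qpoch (a * x) q * qpoch (a / x) q)) *
    aw_weight [:: a; b; c; d] x) 0.
Proof.
move=> hes; apply: is_curve_integral_uniform => // e e0.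
have bc y : ubounded (curve g) (fun=> qpoch y q) by exact: ubounded_cst.
have cc y : ucvg (curve g) (fun n _ => qpochn n y q) (fun=> qpoch y q).
  exact: (@ucvg_qpoch _ _ q1 _ _ (fun=> y) (ubounded_cst _ _)).
have b1 : ubounded (curve g) (fun x => a * x).
  by apply: uboundedM; [exact: ubounded_cst|exact: ubounded_id].
have b4 : ubounded (curve g) (fun x => a / x).
  by apply: uboundedM; [exact: ubounded_cst|exact: ubounded_inv].
have B1 := ubounded_qpoch q1 b1. have B4 := ubounded_qpoch q1 b4.
have C1 := ucvg_qpoch q1 b1. have C4 := ucvg_qpoch q1 b4.
have U3 := uboundedM (uboundedM (bc (a * b)) (bc (a * c))) (bc (a * d)).
have C3 := ucvgM (uboundedM (bc (a * b)) (bc (a * c))) (bc (a * d))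
  (ucvgM (bc (a * b)) (bc (a * c)) (cc (a * b)) (cc (a * c))) (cc (a * d)).
have U5 := uboundedM (bc (a * b * c * d)) (uboundedM B1 B4).
have C5 := ucvgM (bc (a * b * c * d)) (uboundedM B1 B4) (cc (a * b * c * d))
  (ucvgM B1 B4 C1 C4).
have C6 := ucvgM (uboundedB U3 U5) (ubounded_aw_weight hes) (ucvgB C3 C5)
  (@ucvg_cst _ _ _ _).
have [N hN] := C6 _ e0.
eexists; exists 0; split; first exact: (is_curve_integral_aw_iter N hes).
  by rewrite subrr cabs0 ltW.
exact: hN.
Qed.

(** The weight at parameter 0 is [(a x, a / x; q)_oo] times the weight at [a], so the limit relation
    expresses the latter through the former. Existence of the integral is transferred along with its
    value. *)
Lemma is_curve_integral_aw_reduce a b c d I :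
  (forall e, e \in [:: a; b; c; d] -> aw_param e) ->
  qpoch (a * b) q * qpoch (a * c) q * qpoch (a * d) q != 0 ->
  is_curve_integral g (aw_weight [:: 0; b; c; d]) I ->
  is_curve_integral g (aw_weight [:: a; b; c; d])
    (qpoch (a * b * c * d) q / (qpoch (a * b) q * qpoch (a * c) q * qpoch (a * d) q) * I).
Proof.
move=> hes n0 hI; have ha : aw_param a by apply: hes; rewrite mem_head.
set P := qpoch (a * b) q * _ * _ in n0 *.
have := is_curve_integralZ P^-1 (is_curve_integralD (is_curve_integral_aw_limit hes)
  (is_curve_integralZ (qpoch (a * b * c * d) q) hI)).
rewrite add0r mulrA [P^-1 * _]mulrC; apply: is_curve_integral_eq => x cx.
have x0 := curve_neq0 cx.
have /andP[/andP[/andP[a1 a2] a3] a4] := aw_param_qpoch_neq0 ha cx.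
have -> : aw_weight [:: 0; b; c; d] x =
    qpoch (a * x) q * qpoch (a / x) q * aw_weight [:: a; b; c; d] x.
  have := mulf_neq0 a1 a3; rewrite -(qpoch_recl q1) => p1.
  have := mulf_neq0 a2 a4; rewrite -(qpoch_recl q1) => p2.
  rewrite /aw_weight !(big_cons _ _ _ [:: b; c; d]) !mul0r (qpoch0 q1) !mul1r.
  rewrite [(qpoch (a * x) _ * _ * _)^-1]invfM.
  move: (\prod_(e <- _) _)^-1 => Z.
  by field; rewrite x0 p1 p2.
by rewrite -/P; field.
Qed.

Lemma is_curve_integral_aw_perm es1 es2 I : perm_eq es1 es2 ->
  is_curve_integral g (aw_weight es1) I -> is_curve_integral g (aw_weight es2) I.
Proof.
move=> h; apply: is_curve_integral_eq => x _.
by rewrite /aw_weight (perm_big _ h).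
Qed.

End AskeyWilson.

(** * The constant term *)

Section ThetaCoefficients.
Variables (F : fieldType) (q : F).
Hypothesis q0 : q != 0.
Local Notation Q := (q%:P : {poly F}).

Definition theta_left m : {poly F} := \prod_(j < m) ('X - Q ^+ j.+1).
Definition theta_right n : {poly F} := \prod_(j < n) (1 - Q ^+ j * 'X).
(** This is [X^m (X; q)_n (q/X; q)_m], the finite triple product cleared of negative powers. *)
Definition theta_poly m n : {poly F} := theta_left m * theta_right n.

Lemma coef_comp_scale (p : {poly F}) k : (p \Po (Q * 'X))`_k = p`_k * q ^+ k.
Proof.
rewrite comp_polyE coef_sum.
under eq_bigr => i _ do
  rewrite mul_polyC exprZn coefZ coefZ coefXn.
have [kp|kp] := ltnP k (size p).
  rewrite (bigD1 (Ordinal kp)) //= eqxx mulr1 big1 ?addr0 // => i ik.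
  by rewrite eq_sym -[_ == _]/(i == Ordinal kp) (negPf ik) !mulr0.
rewrite nth_default // mul0r big1 // => i _.
by rewrite gtn_eqF ?mulr0 // (leq_trans (ltn_ord i)).
Qed.

Let compQ k (p : {poly F}) : (Q ^+ k) \Po p = Q ^+ k.
Proof. by rewrite -polyC_exp comp_polyC. Qed.

Lemma theta_left_scale m :
  (theta_left m \Po (Q * 'X)) * ('X - Q ^+ m) = Q ^+ m * (('X - 1) * theta_left m).
Proof.
elim: m => [|m ih].
  by rewrite /theta_left big_ord0 comp_polyC expr0 !mul1r mulr1.
rewrite /theta_left big_ord_recr /= -/(theta_left m) comp_polyM comp_polyB comp_polyX compQ.
transitivity (Q * ((theta_left m \Po (Q * 'X)) * ('X - Q ^+ m)) * ('X - Q ^+ m.+1)).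
  by rewrite exprS; ring.
by rewrite ih exprS; ring.
Qed.

Lemma theta_right_scale n :
  (1 - 'X) * (theta_right n \Po (Q * 'X)) = theta_right n * (1 - Q ^+ n * 'X).
Proof.
elim: n => [|n ih].
  by rewrite /theta_right big_ord0 comp_polyC expr0 !mul1r mulr1.
rewrite /theta_right big_ord_recr /= -/(theta_right n) comp_polyM comp_polyB comp_polyM.
rewrite comp_polyX compQ comp_polyC mulrA ih.
by rewrite exprS; ring.
Qed.

(** Under [X -> q X] each linear factor moves to its neighbour, so only the extreme factors change.
    The auxiliary [1 - 'X] joins the two halves and is cancelled in the polynomial domain. *)
Lemma theta_poly_scale m n :
  (theta_poly m n \Po (Q * 'X)) * ('X - Q ^+ m) =
    - Q ^+ m * (1 - Q ^+ n * 'X) * theta_poly m n.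
Proof.
have X1 : 1 - 'X != 0 :> {poly F}.
  by rewrite -oppr_eq0 opprB -['X - 1]/('X - 1%:P) polyXsubC_eq0.
apply: (mulfI X1); rewrite /theta_poly comp_polyM.
transitivity (((theta_left m \Po (Q * 'X)) * ('X - Q ^+ m)) *
  ((1 - 'X) * (theta_right n \Po (Q * 'X)))); first by ring.
by rewrite theta_left_scale theta_right_scale; ring.
Qed.

(** Comparison of the coefficients of [X^(m+1)] in the scaling equation. *)
Lemma theta_coef_rel m n :
  (theta_poly m n)`_m.+1 * (1 - q ^+ m.+1) = - (theta_poly m n)`_m * (1 - q ^+ n).
Proof.
have qm : q ^+ m != 0 by rewrite expf_neq0.
have := congr1 (fun p : {poly F} => p`_m.+1) (theta_poly_scale m n).
have -> : (theta_poly m n \Po (Q * 'X)) * ('X - Q ^+ m) =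
  (theta_poly m n \Po (Q * 'X)) * 'X - (q ^+ m)%:P * (theta_poly m n \Po (Q * 'X)).
  by rewrite [in RHS]rmorphXn /=; ring.
have -> : - Q ^+ m * (1 - Q ^+ n * 'X) * theta_poly m n =
  (q ^+ (m + n))%:P * (theta_poly m n * 'X) - (q ^+ m)%:P * theta_poly m n.
  by rewrite !rmorphXn /= exprD; ring.
rewrite !coefB !coefCM !coefMX !coef_comp_scale /= => h.
apply: (mulfI qm).
move: h; rewrite exprD exprS; set al := _`_m; set be := _`_m.+1 => h.
have -> : q ^+ m * (be * (1 - q * q ^+ m)) =
  (al * q ^+ m - q ^+ m * (be * (q * q ^+ m))) - (q ^+ m * q ^+ n * al - q ^+ m * be) +
  q ^+ m * (- al * (1 - q ^+ n)) by ring.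
by rewrite h subrr add0r.
Qed.

(** The middle coefficient is the Gaussian binomial of [m + n] over [m], with denominators cleared.
    Raising [m] multiplies by ['X - q^(m+1)], so the new middle coefficient combines two adjacent
    old ones, whose ratio is known from [theta_coef_rel]. *)
Lemma theta_coef_mid m n :
  (theta_poly m n)`_m * \prod_(j < m) (1 - q ^+ j.+1) =
  \prod_(j < m) (1 - q ^+ (n + j).+1).
Proof.
elim: m => [|m ih].
  rewrite !big_ord0 mulr1 /theta_poly /theta_left big_ord0 mul1r -horner_coef0.
  rewrite /theta_right horner_prod big1 // => j _.
  by rewrite hornerD hornerN hornerM hornerX mulr0 subr0 hornerC.
rewrite !big_ord_recr /= -ih.
have -> : theta_poly m.+1 n = theta_poly m n * 'X - (q ^+ m.+1)%:P * theta_poly m n.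
  by rewrite /theta_poly /theta_left big_ord_recr /= rmorphXn /=; ring.
rewrite coefB coefMX coefCM /=.
have h := theta_coef_rel m n.
set P := \prod_(i < m) _.
transitivity (P * ((theta_poly m n)`_m * (1 - q ^+ m.+1) - q ^+ m.+1 *
  ((theta_poly m n)`_m.+1 * (1 - q ^+ m.+1)))); first by ring.
by rewrite h addnC -addSn exprD; ring.
Qed.

End ThetaCoefficients.

(** * The integral of the weight without parameters *)

Section ConstantTerm.
Variables (R : realType) (g : R -> R[i]) (q : R[i]).
Hypotheses (cont_g : {within `[0, 1], continuous g}) (closed_g : g 0 = g 1)
  (rect_g : rectifiable g) (ccw_g : counterclockwise g) (int0 : curve_interior g 0)
  (q0 : q != 0) (q1 : cabs q < 1).

Lemma qpochn_q n : qpochn n q q = \prod_(j < n) (1 - q ^+ j.+1).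
Proof. by apply: eq_bigr => j _; rewrite exprS. Qed.

Lemma expr_q_neq1 n : 1 - q ^+ n.+1 != 0.
Proof.
rewrite subr_eq0; apply/eqP => h.
have : cabs (q ^+ n.+1) < 1.
  by rewrite cabsX exprn_ilt1 ?cabs_ge0.
by rewrite -h cabs1 ltxx.
Qed.

Lemma qpochn_q_neq0 n : qpochn n q q != 0.
Proof. by rewrite qpochn_q; apply/prodf_neq0 => j _; exact: expr_q_neq1. Qed.

Lemma qpoch_q_neq0 : qpoch q q != 0.
Proof.
by apply: qpoch_neq0 => // j; rewrite -exprS eq_sym -subr_eq0 expr_q_neq1.
Qed.

(** The net exponent [m - l - 1] is at most -2, nonnegative, or -1; only the last case lacks a
    primitive and contributes the winding number about 0. *)
Lemma is_curve_integral_monomial m l :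
  is_curve_integral g (fun x => x ^+ m * x^-1 ^+ l.+1)
    (if m == l then two_pi_i R else 0).
Proof.
have x0 x : curve g x -> x != 0 by move=> cx; apply/eqP => h; apply: int0.1; rewrite -h.
case: ltngtP => [ml|lm|->].
- apply: is_curve_integral_eq (is_curve_integral_neg_power cont_g closed_g rect_g
    (l - m).-1 int0.1) => x cx; have xn := x0 x cx.
  have lm : (l - m).-1.+1 = (l - m)%N by rewrite prednK // subn_gt0.
  have -> : l.+1 = (m + (l - m).-1.+2)%N by rewrite addnS lm subnKC // ltnW.
  by rewrite subr0 (exprD _ m) mulrA -exprMn divff // expr1n mul1r.
- apply: is_curve_integral_eq (is_curve_integral_pos_power cont_g closed_g rect_g 0
    (m - l.+1)) => x cx; have xn := x0 x cx.
  rewrite -[in RHS](subnK lm) subr0 exprD -mulrA -exprMn divff // expr1n mulr1 //.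
- apply: is_curve_integral_eq (ccw_g int0) => x cx; have xn := x0 x cx.
  by rewrite subr0 exprS mulrCA -exprMn divff // expr1n mulr1.
Qed.

Lemma theta_poly_eval n (y : R[i]) : y != 0 ->
  (theta_poly q n n).[y] = y ^+ n * (qpochn n y q * qpochn n (q / y) q).
Proof.
move=> y0; rewrite /theta_poly hornerM /theta_left /theta_right !horner_prod.
have -> : \prod_(j < n) ('X - (q%:P : {poly R[i]}) ^+ j.+1).[y] = y ^+ n * qpochn n (q / y) q.
  rewrite -[n in y ^+ n]card_ord -prodr_const -big_split /=; apply: eq_bigr => j _.
  by rewrite -polyC_exp hornerXsubC exprS; field.
have -> : \prod_(j < n) (1 - (q%:P : {poly R[i]}) ^+ j * 'X).[y] = qpochn n y q.
  by apply: eq_bigr => j _; rewrite hornerD hornerN hornerM hornerX -polyC_exp !hornerC mulrC.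
by ring.
Qed.

(** With [y = x^2], the product [(y, q/y; q)_n] is [y^(-n)] times the polynomial [A]. Hence the
    terms 1 and [x ^- 2] of the first factor pick out the coefficients of index [n] and [n + 1]. *)
Lemma is_curve_integral_theta n :
  is_curve_integral g
    (fun x => (1 - x ^- 2) * (qpochn n (x ^+ 2) q * qpochn n (q * x ^- 2) q) / x)
    (two_pi_i R * ((theta_poly q n n)`_n - (theta_poly q n n)`_n.+1)).
Proof.
have x0 x : curve g x -> x != 0 by move=> cx; apply/eqP => h; apply: int0.1; rewrite -h.
set A := theta_poly q n n.
(* Large enough for the sum to exhaust [A] and for the indices [n] and [n.+1] both to occur in
   it. *)
pose N := maxn (size A) n.+2.
have pick m : (m < N)%N ->
    \sum_(k < N) A`_k * (if k.*2 == m.*2 then two_pi_i R else 0) = two_pi_i R * A`_m.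
  move=> mN; rewrite (bigD1 (Ordinal mN)) //= eqxx big1 ?addr0 1?mulrC // => k km.
  by rewrite (inj_eq double_inj) -[_ == _]/(k == Ordinal mN) (negPf km) mulr0.
have := is_curve_integralD
  (is_curve_integral_sum (index_enum 'I_N) (fun k : 'I_N =>
     is_curve_integralZ A`_k (is_curve_integral_monomial k.*2 n.*2)))
  (is_curve_integralZ (-1) (is_curve_integral_sum (index_enum 'I_N) (fun k : 'I_N =>
     is_curve_integralZ A`_k (is_curve_integral_monomial k.*2 n.+1.*2)))).
rewrite !pick ?leq_max ?ltnSn ?orbT //; last by rewrite (ltnW (ltnSn _)) orbT.
rewrite mulN1r -mulrBr; apply: is_curve_integral_eq => x cx; have xn := x0 x cx.
have AE : \sum_(k < N) A`_k * x ^+ k.*2 = A.[x ^+ 2].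
  rewrite (@horner_coef_wide _ N) ?leq_maxl //; apply: eq_bigr => k _.
  by rewrite -exprM mul2n.
have sumE l : \sum_(k < N) A`_k * (x ^+ k.*2 * x^-1 ^+ l.+1) = A.[x ^+ 2] * x^-1 ^+ l.+1.
  by rewrite -AE mulr_suml; apply: eq_bigr => k _; rewrite mulrA.
rewrite !sumE theta_poly_eval ?expf_neq0 //.
set U := qpochn _ _ _; set V := qpochn _ _ _.
have -> : (x ^+ 2) ^+ n = x ^+ n.*2 by rewrite -exprM mul2n.
have xx : x ^+ n.*2 * x^-1 ^+ n.*2 = 1 by rewrite -exprMn divff // expr1n.
rewrite mulN1r doubleS !(exprS _ _.+1) (exprS _ n.*2).
transitivity ((x ^+ n.*2 * x^-1 ^+ n.*2) * (U * V * x^-1 - U * V * x^-1 * x^-1 * x^-1)).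
  by ring.
by rewrite xx mul1r; field.
Qed.

(** The coefficient of index [n] is [(q; q)_2n / (q; q)_n^2], which tends to [1 / (q; q)_oo]; the
    next one is its multiple by [-(1 - q^n) / (1 - q^(n+1))] and tends to the opposite value. Hence
    the factor 2. *)
Lemma theta_coef_limit (e : R) : 0 < e -> exists N : nat, forall n, (N <= n)%N ->
  cabs (((theta_poly q n n)`_n - (theta_poly q n n)`_n.+1) - 2 / qpoch q q) <= e.
Proof.
(* Numerical sequences are viewed as functions on a one-point set, so that the calculus of [ucvg]
   applies. *)
pose T := [set: unit].
have uc (c : R[i]) : ubounded T (fun=> c) by exact: ubounded_cst.
have Q1 : ucvg T (fun n _ => qpochn n q q) (fun=> qpoch q q).
  exact: (@ucvg_qpoch _ _ q1 _ _ (fun=> q) (uc q)).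
have Q2 : ucvg T (fun n _ => qpochn (n + n) q q) (fun=> qpoch q q).
  by move=> d d0; have [N hN] := Q1 d d0; exists N => n Nn; apply: hN; exact: leq_trans (leq_addr _ _).
have QV : ucvg T (fun n _ => (qpochn n q q)^-1) (fun=> (qpoch q q)^-1).
  by apply: ucvgV Q1; exists (cabs (qpoch q q)) => //; rewrite cabs_gt0 qpoch_q_neq0.
have P0 : ucvg T (fun n _ => q ^+ n) (fun=> 0).
  move=> d d0; have [|N hN] := @expr_small R (cabs q) 1 d _ d0; first by rewrite cabs_ge0.
  by exists N => n /hN h _ _; rewrite subr0 cabsX; rewrite mul1r in h; exact: ltW.
have P1 : ucvg T (fun n _ => q ^+ n.+1) (fun=> 0).
  by move=> d d0; have [N hN] := P0 d d0; exists N => n Nn; apply: hN; exact: leqW.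
have D0 := ucvgB (@ucvg_cst _ _ T (fun=> 1)) P0.
have D1 := ucvgB (@ucvg_cst _ _ T (fun=> 1)) P1.
have DV : ucvg T (fun n _ => (1 - q ^+ n.+1)^-1) (fun=> (1 - 0)^-1).
  by apply: ucvgV D1; exists 1 => // x _; rewrite subr0 cabs1.
have A := ucvgM (uc (qpoch q q)) (uc ((qpoch q q)^-1 * (qpoch q q)^-1)) Q2
  (ucvgM (uc (qpoch q q)^-1) (uc (qpoch q q)^-1) QV QV).
have B := ucvgM (uc (1 - 0)) (uc (1 - 0)^-1) D0 DV.
have C := ucvgM (uc _) (uc _) A (ucvgB (@ucvg_cst _ _ T (fun=> 1)) (ucvgM (uc (-1)) (uc _) (@ucvg_cst _ _ T (fun=> -1)) B)).
move=> e0; have [N hN] := C e e0; exists N => n Nn.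
have {hN} := hN n Nn tt I; rewrite !subr0 invr1 !mulr1.
have Qn := qpoch_q_neq0.
have -> : qpoch q q * ((qpoch q q)^-1 * (qpoch q q)^-1) * (1 - -1) = 2 / qpoch q q.
  by field.
apply: le_trans; apply: eq_ler; congr (cabs (_ - _)).
have h1 := theta_coef_mid q0 n n; have h2 := theta_coef_rel q0 n n.
set al := _`_n in h1 h2 *; set be := _`_n.+1 in h2 *.
have q2 := qpochn_q_neq0 n; have q3 := expr_q_neq1 n.
have -> : be = - al * (1 - q ^+ n) / (1 - q ^+ n.+1) by rewrite -h2 mulfK.
have -> : al = qpochn (n + n) q q * ((qpochn n q q)^-1 * (qpochn n q q)^-1).
  rewrite qpochnD mulrA -mulrA; rewrite -qpochn_q in h1.
  have -> : qpochn n (q * q ^+ n) q = al * qpochn n q q.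
    by rewrite h1; apply: eq_bigr => j _; rewrite -exprS -exprD addSn.
  by field.
by ring.
Qed.

Lemma is_curve_integral_aw_weight0 :
  is_curve_integral g (aw_weight q [:: 0; 0; 0; 0]) (two_pi_i R * (2 / qpoch q q)).
Proof.
apply: is_curve_integral_uniform => // e e0.
have b1 := ubounded_id cont_g. have b2 := ubounded_inv cont_g int0.
have b3 : ubounded (curve g) (fun x => x ^+ 2) by have := uboundedM b1 b1.
have b4 : ubounded (curve g) (fun x => x ^- 2).
  by have [M hM] := uboundedM b2 b2; exists M => x cx; rewrite -exprVn expr2; exact: hM.
have b5 : ubounded (curve g) (fun x => q * x ^- 2).
  by apply: uboundedM; first exact: ubounded_cst.
have c1 := ucvg_qpoch q1 b3. have c2 := ucvg_qpoch q1 b5.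
have B1 := ubounded_qpoch q1 b3. have B2 := ubounded_qpoch q1 b5.
have b6 := uboundedB (ubounded_cst (curve g) 1) b4.
have C := ucvgM (uboundedM b6 (uboundedM B1 B2)) b2
  (ucvgM b6 (uboundedM B1 B2) (@ucvg_cst _ _ _ _) (ucvgM B1 B2 c1 c2)) (@ucvg_cst _ _ _ _).
have [N hN] := C e e0.
have tp := cabs_ge0 (two_pi_i R).
have [|M hM] := @theta_coef_limit (e / (cabs (two_pi_i R) + 1)).
  by apply: divr_gt0 => //; lra.
(* The index [N + M] is large enough both for the uniform convergence of the integrand and for the
   convergence of the integrals. *)
eexists; exists (two_pi_i R * ((theta_poly q (N + M) (N + M))`_(N + M) -
   (theta_poly q (N + M) (N + M))`_(N + M).+1)); split.
- exact: is_curve_integral_theta.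
- have := hM (N + M)%N (leq_addl _ _); rewrite -mulrBr (cabsM (two_pi_i R)) ler_pdivlMr; last lra.
  set z := cabs (_ - _); have : 0 <= z by exact: cabs_ge0.
  nra.
- move=> x cx; have := hN (N + M)%N (leq_addr _ _) x cx; apply: le_trans; apply: eq_ler.
  congr (cabs (_ - _)).
  rewrite /aw_weight !big_cons big_nil !mul0r (qpoch0 q1) !mulr1 invr1 mulr1.
  have -> : qpoch (x ^- 2) q = (1 - x ^- 2) * qpoch (q * x ^- 2) q.
    by rewrite [q * _]mulrC; exact: qpoch_recl.
  by rewrite mulrCA.
Qed.

End ConstantTerm.

(** * The four parameters restored one at a time *)

Theorem theorem12p7 (R : realType)
  (q sqrt_q k0 k1 u0 u1 a b c d : R[i]) (g : R -> R[i])
  (hq0 : 0 < `|q|) (hq1 : `|q| < 1) (hsq : sqrt_q ^+ 2 = q)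
  (hk0 : k0 != 0) (hk1 : k1 != 0) (hu0 : u0 != 0) (hu1 : u1 != 0)
  (ha : a = k1 * u1) (hb : b = - k1 * u1^-1)
  (hc : c = sqrt_q * k0 * u0) (hd : d = - sqrt_q * k0 * u0^-1)
  (hk0q : forall j : int, k0 ^+ 2 != q ^ j /\ k0 ^+ 2 != - q ^ j)
  (hk1q : forall j : int, k1 ^+ 2 != q ^ j /\ k1 ^+ 2 != - q ^ j)
  (hu1q : forall j : int, u1 ^+ 2 != q ^ j /\ u1 ^+ 2 != - q ^ j)
  (hef : forall e f, e \in [:: a; b; c; d] -> f \in [:: a; b; c; d] ->
     forall j : int, e * f != q ^ j)
  (hjordan : jordan_curve g) (hrect : rectifiable g)
  (hccw : counterclockwise g)
  (hint : forall e, e \in [:: a; b; c; d] ->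
     forall k : nat, curve_interior g (e * q ^+ k))
  (hint0 : curve_interior g 0)
  (hext : forall e, e \in [:: a; b; c; d] ->
     forall k : nat, curve_exterior g (e^-1 * q ^- k)) :
  exists2 I : R[i],
    is_curve_integral g
      (fun x => qpochs [:: x ^+ 2; x ^- 2] q /
                qpochs [:: a * x; a * x^-1; b * x; b * x^-1;
                           c * x; c * x^-1; d * x; d * x^-1] q / x) I
    & (two_pi_i R)^-1 * I =
      2 * qpoch (a * b * c * d) q /
        qpochs [:: q; a * b; a * c; a * d; b * c; b * d; c * d] q.
Proof.
have q0 : q != 0 by rewrite -normr_gt0.
have q1 : cabs q < 1 by rewrite -ltcR -cabsE.
have [cont_g closed_g _] := hjordan.
have hpar e : e \in [:: a; b; c; d] -> aw_param g q e.
  by move=> he; split=> [k|_ k]; [exact: hint|exact: hext].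
have hneq e f : e \in [:: a; b; c; d] -> f \in [:: a; b; c; d] -> qpoch (e * f) q != 0.
  move=> he hf; apply: qpoch_neq0 => // j; apply/eqP => h.
  (* A vanishing factor of index [j] would mean [e * f = q ^ (- j)], hence the negative exponent. *)
  have /eqP := hef e f he hf (- j%:Z); apply.
  by rewrite -exprnN -[LHS](mulfK (expf_neq0 j q0)) h mul1r.
have [ma mb mc md] : [/\ a \in [:: a; b; c; d], b \in [:: a; b; c; d],
    c \in [:: a; b; c; d] & d \in [:: a; b; c; d]].
  by rewrite !inE !eqxx !orbT.
have p0 := @aw_param0 _ _ q hint0.
have pa := hpar a ma. have pb := hpar b mb. have pc := hpar c mc. have pd := hpar d md.
have all4 e1 e2 e3 e4 : aw_param g q e1 -> aw_param g q e2 -> aw_param g q e3 ->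
    aw_param g q e4 -> forall e, e \in [:: e1; e2; e3; e4] -> aw_param g q e.
  by move=> h1 h2 h3 h4 e; rewrite !inE => /or4P[] /eqP->.
have ab := hneq a b ma mb. have ac := hneq a c ma mc. have ad := hneq a d ma md.
have bc := hneq b c mb mc. have bd := hneq b d mb md. have cd := hneq c d mc md.
have red e1 e2 e3 e4 I h := @is_curve_integral_aw_reduce R g q cont_g closed_g hrect hccw
  hint0 q0 q1 e1 e2 e3 e4 I h.
have w0 := is_curve_integral_aw_weight0 cont_g closed_g hrect hccw hint0 q0 q1.
(* The parameters come back in the order [d], [c], [b], [a]. Every product involving a parameter
   that is still 0 equals 1, so the successive factors are 1, then [1 / (cd)], then [1 / (bc, bd)],
   and finally [(abcd) / (ab, ac, ad)], each standing for its infinite products. *)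
have w1 := red d 0 0 0 _ (all4 _ _ _ _ pd p0 p0 p0) _ w0.
rewrite !(mulr0, mul0r) !(qpoch0 q1) !mul1r invr1 mul1r in w1.
have {}w1 := w1 (oner_neq0 _).
(* The reduction acts on the first parameter, so a 0 is rotated to the front before each further
   use. *)
have pm1 : perm_eq [:: d; 0; 0; 0] [:: 0; 0; 0; d] by rewrite (perm_catC [:: d] [:: 0; 0; 0]).
have w2 := red c 0 0 d _ (all4 _ _ _ _ pc p0 p0 pd) _ (is_curve_integral_aw_perm pm1 w1).
rewrite !(mulr0, mul0r) !(qpoch0 q1) !mul1r in w2.
have {}w2 := w2 cd.
have pm2 : perm_eq [:: c; 0; 0; d] [:: 0; 0; c; d].
  by rewrite (perm_catCA [:: c] [:: 0; 0] [:: d]).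
have w3 := red b 0 c d _ (all4 _ _ _ _ pb p0 pc pd) _ (is_curve_integral_aw_perm pm2 w2).
rewrite !(mulr0, mul0r) !(qpoch0 q1) !mul1r in w3.
have {}w3 := w3 (mulf_neq0 bc bd).
have pm3 : perm_eq [:: b; 0; c; d] [:: 0; b; c; d].
  by rewrite (perm_catCA [:: b] [:: 0] [:: c; d]).
have w4 := red a b c d _ (all4 _ _ _ _ pa pb pc pd) (mulf_neq0 (mulf_neq0 ab ac) ad)
  (is_curve_integral_aw_perm pm3 w3).
eexists.
  apply: is_curve_integral_eq w4 => x _.
  by rewrite /aw_weight /qpochs !big_cons !big_nil !mulr1 !mulrA.
have tp : two_pi_i R != 0.
  have pi0 : (pi%:C : R[i]) != 0 by rewrite fmorph_eq0 gt_eqF ?pi_gt0.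
  have i0 : ('i%C : R[i]) != 0 by rewrite eq_complex /= oner_eq0 andbF.
  by rewrite /two_pi_i mulf_neq0 // mulf_neq0 // pnatr_eq0.
have qq := qpoch_q_neq0 q1.
rewrite /qpochs !big_cons !big_nil !mulr1.
by field; rewrite ab ac ad bc bd cd qq tp.
Qed.
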